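(* In the setting described in the context, let $\lambda_{k(n)}$ be the smallest eigenvalue of the $k(n)\times k(n)$ covariance matrix $\Sigma_{k(n)}$. Assume that $$\frac{\log k(n)}{\lambda_{k(n)}} = o_{\mathbb{P}}(\log n) \qquad (n\to\infty).$$ Then, under the null hypothesis $H_0: f=f_0$, the data driven test statistic $T_{S_n}$ converges in distribution, as $n\to\infty$, to a Chi-squared random variable with $1$ degree of freedom.
   Context: Model. Let $X=Y+Z$, where $Y$ and $Z$ are independent real random variables with densities $f$ and $g$ with respect to a reference measure $\nu$, which is either the Lebesgue measure on $\mathbb{R}$ (or on an interval) or a counting measure $\sum_n\delta_n$. The density $g$ of $Z$ is known. Let $X_1,X_2,\ldots$ be i.i.d. random variables distributed as $X$, with density $h$ with respect to $\nu$; only these variables are observed. Let $f_0$ be a fixed density; the null hypothesis is $H_0: f=f_0$, tested against $f\neq f_0$. Basis. Let $\mu$ be a probability measure on $\mathbb{R}$ with density $m$ with respect to $\nu$, such that the distributions of $Y$ and $X$ are both dominated by $\mu$. Let $\{Q_i : i=0,1,2,\ldots\}$ be a dense family of orthogonal functions (orthogonal basis) of $L^2(\mu)$. It is assumed that $h\in L^2(\mu)$. For $i\ge 1$, let $\alpha_i$ be the value under $H_0$ of $\mathbb{E}(Q_i(X)m(X))$, i.e. $\alpha_i=\mathbb{E}(Q_i(Y+Z)m(Y+Z))$ with $Y$ of density $f_0$ and $Z$ of density $g$ independent. Statistics. For integers $k\ge1$ and $n\geq 1$ put $B_k=(\widehat b_1,\ldots,\widehat b_k)$, where $$\widehat b_j=\frac{1}{\sqrt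 n}\sum_{i=1}^n\big(Q_j(X_i)m(X_i)-\alpha_j\big).$$ Let $\Sigma_k=\mathrm{Var}(B_k)$ be its $k\times k$ covariance matrix under $H_0$; equivalently, $\Sigma_k$ is the covariance matrix under $H_0$ of $(Q_1(X)m(X),\ldots,Q_k(X)m(X))$, which does not depend on $n$. It is assumed to be well defined (finite second moments) and invertible. Put $U_k=\Sigma_k^{-1/2}B_k^T$ and $T_k=\|U_k\|^2=B_k\Sigma_k^{-1}B_k^T$, where $\|\cdot\|$ is the Euclidean norm. Selection rule. Let $k(n)$ be an increasing sequence of positive integers with $\lim_{n\to\infty}k(n)=\infty$, and define $$S_n=\min\Big\{\operatorname*{argmax}_{1\le k\le k(n)}\big(T_k-k\log(n)\big)\Big\},$$ the smallest index in $\{1,\ldots,k(n)\}$ maximizing $T_k-k\log(n)$. The data driven test statistic is $T_{S_n}$, i.e. $T_k$ evaluated at $k=S_n$. Notation: $o_{\mathbb{P}}(\log n)$ denotes a quantity which, divided by $\log n$, tends to $0$ in probability (for deterministic quantities, an ordinary $o(\log n)$). *)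

(* Defs.v *)
From HB Require Import structures.
From mathcomp Require Import all_boot all_order all_algebra.
From mathcomp Require Import all_classical all_reals all_analysis.

Set Implicit Arguments.
Unset Strict Implicit.
Unset Printing Implicit Defensive.

Import Order.TTheory GRing.Theory Num.Theory.
Import numFieldNormedType.Exports.

Local Open Scope classical_set_scope.
Local Open Scope ring_scope.

(* Lebesgue measure on an interval (the choice ]-oo, +oo[ gives the whole
   line), or the counting measure \sum_n \delta_n; as the range of n varies
   (nat, int, a finite range), it is an arbitrary set of integers here. *)
Definition reference_measure (R : realType)
    (nu : set (measurableTypeR R) -> \bar R) : Prop :=
  (exists I : interval R, forall B, measurable B ->
     nu B = lebesgue_measure (B `&` [set` I])) \/
  (exists N : set int, forall B, measurable B ->
     nu B = \esum_(n in N) \d_(n%:~R : measurableTypeR R) B)%E.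

Definition has_density (R : realType)
    (nu : {measure set (measurableTypeR R) -> \bar R})
    (D : set (measurableTypeR R) -> \bar R) (f : R -> R) : Prop :=
  [/\ measurable_fun [set: R] f, (forall x, 0 <= f x)
    & forall B, measurable B -> D B = (\int[nu]_(x in B) (f x)%:E)%E].

Definition law d (Omega : measurableType d) (R : realType)
    (P : probability Omega R) (V : Omega -> R) :
    set (measurableTypeR R) -> \bar R := pushforward P V.

Definition independent2 d (Omega : measurableType d) (R : realType)
    (P : probability Omega R) (Y Z : Omega -> R) : Prop :=
  forall A B : set (measurableTypeR R), measurable A -> measurable B ->
    P ((Y @^-1` A) `&` (Z @^-1` B)) = (P (Y @^-1` A) * P (Z @^-1` B))%E.

Definition mutually_independent d (Omega : measurableType d) (R : realType)
    (P : probability Omega R) (X : nat -> Omega -> R) : Prop :=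
  forall (s : seq nat) (A : nat -> set (measurableTypeR R)),
    uniq s -> (forall i, measurable (A i)) ->
    P (\big[setI/setT]_(i <- s) (X i @^-1` A i)) =
    (\prod_(i <- s) P (X i @^-1` A i))%E.

Definition noise_model d (Omega : measurableType d) (R : realType)
    (P : probability Omega R)
    (nu : {measure set (measurableTypeR R) -> \bar R})
    (Y Z : {RV P >-> R}) (f g : R -> R) : Prop :=
  [/\ independent2 P Y Z, has_density nu (law P Y) f
    & has_density nu (law P Z) g].

Definition orthogonal_basis (R : realType)
    (mu : probability (measurableTypeR R) R) (Q : nat -> R -> R) : Prop :=
  [/\ (forall i, Q i \in Lfun mu 2%:E),
      (forall i, 'N[mu]_2%:E[EFin \o Q i] != 0)%E,
      (forall i j, i != j -> (\int[mu]_x (Q i x * Q j x)%:E)%E = 0%E)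
    & forall phi : R -> R, phi \in Lfun mu 2%:E ->
      forall e : R, 0 < e ->
      exists (N : nat) (c : 'I_N -> R),
        ('N[mu]_2%:E[EFin \o (fun x => phi x - \sum_(i < N) c i * Q i x)%R]
           < e%:E)%E].

Definition Qm (R : realType) (Q : nat -> R -> R) (m : R -> R) (j : nat) :
    R -> R := fun x => Q j x * m x.

Section null_moments.
Context d (Omega : measurableType d) (R : realType) (P : probability Omega R).
Variables (psi : nat -> R -> R) (X : Omega -> R).

Definition alpha (j : nat) : R := fine 'E_P[psi j \o X].

(* Indices i : 'I_k stand for i.+1 in {1, ..., k}, psi 0 being unused.  For an
   i.i.d. sample of the law of X, this is Var(B_k) for every sample size. *)
Definition Sigma (k : nat) : 'M[R]_k :=
  \matrix_(i, j) fine (covariance P (psi i.+1 \o X) (psi j.+1 \o X)).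

End null_moments.

Definition is_smallest_eigenvalue (R : realType) (k : nat) (A : 'M[R]_k)
    (l : R) : Prop :=
  eigenvalue A l /\ forall a, eigenvalue A a -> l <= a.

Section statistics.
Context (Omega : Type) (R : realType).
Variables (psi : nat -> R -> R) (al : nat -> R) (Sig : forall k, 'M[R]_k).
(* The sample (X_1, ..., X_n) is (X 0, ..., X n.-1). *)
Variable X : nat -> Omega -> R.

Definition bhat (n j : nat) (w : Omega) : R :=
  (Num.sqrt n%:R)^-1 * \sum_(i < n) (psi j (X i w) - al j).

Definition Bvec (n k : nat) (w : Omega) : 'rV[R]_k := \row_(j < k) bhat n j.+1 w.

Definition Tstat (n k : nat) (w : Omega) : R :=
  (Bvec n k w *m invmx (Sig k) *m (Bvec n k w)^T) 0 0.

(* The smallest k in {1, ..., K} at which c is maximal. *)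
Definition first_argmax (K : nat) (c : nat -> R) : nat :=
  head 0%N [seq k <- iota 1 K | all (fun l => c l <= c k) (iota 1 K)].

Definition Ssel (kn : nat -> nat) (n : nat) (w : Omega) : nat :=
  first_argmax (kn n) (fun k => Tstat n k w - k%:R * ln n%:R).

End statistics.

(* Chi-squared law with 1 degree of freedom, as the law of the square of a
   standard normal random variable. *)
Definition chi_square1 (R : realType) : set (measurableTypeR R) -> \bar R :=
  pushforward (normal_prob (0 : R) 1) (fun x : R => x ^+ 2).

Definition cvg_in_distribution d (Omega : measurableType d) (R : realType)
    (P : probability Omega R) (V : nat -> Omega -> R)
    (D : set (measurableTypeR R) -> \bar R) : Prop :=
  let cdf_of (L : set (measurableTypeR R) -> \bar R) (y : R) : \bar R :=
    L [set t : R | t <= y] in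
  forall x : R, {for x, continuous (cdf_of D)} ->
    cdf_of (law P (V n)) x @[n --> \oo] --> cdf_of D x.

(* Main.v *)
Require Import Defs.
From HB Require Import structures.
From mathcomp Require Import all_boot all_order all_algebra.
From mathcomp Require Import all_classical all_reals all_analysis.
From mathcomp Require Import measurable_realfun ring lra.

Set Implicit Arguments.
Unset Strict Implicit.
Unset Printing Implicit Defensive.

Import Order.TTheory GRing.Theory Num.Theory.
Import numFieldNormedType.Exports.

Local Open Scope classical_set_scope.
Local Open Scope ring_scope.

(** The statistic [T_(S_n)] has the announced limit because the selection rule
    picks dimension 1 with probability tending to one, and [T_1] is the square
    of a normalised i.i.d. sum, so that the central limit theorem applies.

    Under the null hypothesis the observations have the law of [Y0 + Z0]: the
    densities of [Y] and [Y0] agree almost everywhere, and a law on the plane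
    is determined by its values on rectangles ([law_add_eq]).  Hence [alpha] and
    [Sigma] are the true means and covariances of the scores.

    Selection ([selection_dyadic_exceedance], [prob_dyadic_exceedance]).  Write
    [L = ln n].  If [S_n <> 1], some [k] with [2 <= k <= k(n)] has
    [T_k - k L > T_1 - L], hence [T_k > (k - 1) L].  A union bound over [k] with
    Markov's inequality is too weak, since [E T_k = k] makes each term of order
    [1 / L].  But [T_k] is nondecreasing in [k], because the inverse quadratic
    form is a supremum of [2 <y, b> - y Sigma y] over [y], and enlarging [k]
    enlarges the range of [y] ([score_statistic_mono]).  So if
    [2 ^ i <= k < 2 ^ (i + 1)] then already [T_(2 ^ (i + 1)) >= 2 ^ (i + 1) L / 4],
    an event of probability at most [4 / L]; only [log_2 k(n)] dyadic blocks
    occur, and [P (S_n <> 1)] is at most a constant times [ln k(n) / ln n].  This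
    tends to 0: the smallest eigenvalue [lambda_k] is positive and bounded above
    by the first diagonal entry of [Sigma_k], which does not depend on [k], so
    the assumption on [ln k(n) / lambda_(k(n))] implies
    [ln k(n) = o(ln n)].

    Central limit theorem ([clt_logistic]).  The averaging operator of a law [F]
    sends [phi] to [x |-> E phi(x + t V)], [V] of law [F].  The expectation of
    [phi] at an i.i.d. sum is an [n]-fold iterate of this operator, which is a
    contraction and commutes with the operator of the Gaussian law; so it is
    enough that the two operators differ by [o(1 / n)] for [t = 1 / sqrt n]
    ([shift_mean_iter_dist]), which a second-order Taylor expansion gives as
    both laws are centred with variance 1.  The iterates of the Gaussian operator collapse
    to a single one because a sum of independent Gaussians is Gaussian
    ([gaussian_semigroup]).  The test functions are logistic functions: their
    derivatives are polynomials in themselves, hence bounded.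

    Conclusion ([cvg_in_distribution_chi_square1]).  Differences of steep
    logistic functions squeeze the indicator of [w ^ 2 <= x], and continuity of
    the limit distribution function at [x] lets the squeeze close up. *)

(** * Quadratic forms and the smallest eigenvalue *)

Section quadratic_forms.
Variable R : realType.

Definition quad k (A : 'M[R]_k) (x : 'rV[R]_k) : R := (x *m A *m x^T) 0 0.

Definition psd k (A : 'M[R]_k) : Prop := A^T = A /\ forall x, 0 <= quad A x.

Lemma quadE k (A : 'M[R]_k) x : quad A x = \sum_i \sum_j x 0 i * A i j * x 0 j.
Proof.
rewrite /quad mxE exchange_big; apply: eq_bigr => j _.
by rewrite !mxE big_distrl.
Qed.

Lemma quadZ k (A : 'M[R]_k) (a : R) x : quad A (a *: x) = a ^+ 2 * quad A x.
Proof.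
by rewrite /quad linearZ/= -!scalemxAl -scalemxAr !mxE mulrA expr2.
Qed.

Lemma quad_scalar k (a : R) (x : 'rV[R]_k) :
  quad a%:M x = a * \sum_i x 0 i ^+ 2.
Proof.
rewrite /quad mul_mx_scalar -scalemxAl !mxE; congr (_ * _).
by apply: eq_bigr => i _; rewrite !mxE expr2.
Qed.

Lemma quadB k (A B : 'M[R]_k) x : quad (A - B) x = quad A x - quad B x.
Proof. by rewrite /quad mulmxBr mulmxBl !mxE. Qed.

(** Completing the square: the difference of both sides is the form of [A] at
    [b A^-1 - y].  Together with [quad_invmxE] this presents [quad (invmx A) b]
    as a maximum over [y], which is what makes it comparable across
    dimensions. *)
Lemma quad_invmx_ge k (A : 'M[R]_k) (b y : 'rV[R]_k) : psd A -> A \in unitmx ->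
  (y *m b^T) 0 0 *+ 2 - quad A y <= quad (invmx A) b.
Proof.
move=> [Asym Apos] Au; have AiT : (invmx A)^T = invmx A by rewrite trmx_inv Asym.
have := Apos (b *m invmx A - y); rewrite /quad linearB/= trmx_mul AiT.
rewrite mulmxBl mulmxKV// mulmxBr !mulmxBl !mulmxA mulmxK//.
have -> : b *m y^T = y *m b^T.
  apply/matrixP => i j; rewrite !ord1 !mxE.
  by apply: eq_bigr => l _; rewrite !mxE mulrC.
by rewrite !mxE mulr2n; lra.
Qed.

Lemma quad_invmxE k (A : 'M[R]_k) (b : 'rV[R]_k) : A^T = A -> A \in unitmx ->
  let y := b *m invmx A in
  quad (invmx A) b = (y *m b^T) 0 0 *+ 2 - quad A y.
Proof.
move=> Asym Au y; have AiT : (invmx A)^T = invmx A by rewrite trmx_inv Asym.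
by rewrite /quad /y trmx_mul AiT mulmxKV// !mulmxA mulr2n addrK.
Qed.

(** The maximiser for the leading block, padded with zeros, is a competitor in
    the variational problem for the whole matrix. *)
Lemma quad_invmx_ulsub k l (A : 'M[R]_(k + l)) (b : 'rV[R]_(k + l)) :
  psd A -> A \in unitmx -> ulsubmx A \in unitmx ->
  quad (invmx (ulsubmx A)) (lsubmx b) <= quad (invmx A) b.
Proof.
move=> Apsd Au ulu; have [Asym _] := Apsd.
rewrite quad_invmxE//; last by rewrite trmx_ulsub Asym.
set y := lsubmx b *m _.
have := quad_invmx_ge b (row_mx y 0) Apsd Au.
rewrite -{1}[b]hsubmxK tr_row_mx mul_row_col mul0mx addr0.
suff -> : quad A (row_mx y 0) = quad (ulsubmx A) y by [].
rewrite /quad -{1}[A]submxK mul_row_block !mul0mx !addr0 tr_row_mx.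
by rewrite mul_row_col trmx0 mulmx0 addr0.
Qed.

Lemma quad_bound k (A : 'M[R]_k) : exists2 C : R, 0 < C &
  forall x : 'rV[R]_k, \sum_i x 0 i ^+ 2 = 1 -> quad A x <= C.
Proof.
exists (1 + \sum_i \sum_j `|A i j|).
  by rewrite ltr_pwDl// sumr_ge0// => i _; rewrite sumr_ge0.
move=> x x1; have xle i : `|x 0 i| <= 1.
  rewrite -(@ler_pXn2r _ 2) ?nnegrE// expr1n real_normK ?num_real//.
  by rewrite -x1 (bigD1 i)//= lerDl sumr_ge0// => j _; exact: sqr_ge0.
rewrite quadE ler_wpDl//; apply: ler_sum => i _; apply: ler_sum => j _.
rewrite (le_trans (ler_norm _))// !normrM -[leRHS]mulr1.
rewrite ler_pM ?mulr_ge0// -[leRHS]mul1r.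
by rewrite ler_wpM2r.
Qed.

Section smallest_eigenvalue.
Variables (k : nat) (A : 'M[R]_k) (l : R).
Hypotheses (Apsd : psd A) (lmin : is_smallest_eigenvalue A l).

Lemma smallest_eigenvalue_gt0 : A \in unitmx -> 0 < l.
Proof.
move=> Au; have [/eigenvalueP[v vA v0] _] := lmin.
have vl : quad A v = l * \sum_i v 0 i ^+ 2.
  rewrite /quad vA -scalemxAl !mxE; congr (_ * _).
  by apply: eq_bigr => i _; rewrite !mxE expr2.
have vpos : 0 < \sum_i v 0 i ^+ 2.
  rewrite lt0r sumr_ge0 ?andbT => [|i _]; last exact: sqr_ge0.
  apply: contra v0 => /eqP /psumr_eq0P vi; apply/eqP/rowP => i.
  by rewrite mxE; apply/eqP; rewrite -sqrf_eq0 vi// => j _; exact: sqr_ge0.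
rewrite lt0r; apply/andP; split; last first.
  by rewrite -(pmulr_lge0 _ vpos) -vl; exact: Apsd.2.
apply: contra v0 => /eqP l0; rewrite -[v](mulmxK Au) vA l0 scale0r mul0mx//.
Qed.

(** The infimum [r] of the Rayleigh quotient is an eigenvalue, without any
    compactness: [A - r] is positive semidefinite, and were it invertible, the
    variational inequality would bound its form below on the unit sphere by a
    positive constant, contradicting the choice of [r].  The diagonal entry is
    the quotient at a basis vector. *)
Lemma smallest_eigenvalue_le i : l <= A i i.
Proof.
pose E := [set quad A x | x in [set x : 'rV[R]_k | \sum_j x 0 j ^+ 2 = 1]].
have e1 : \sum_j (delta_mx 0 i : 'rV[R]_k) 0 j ^+ 2 = 1.
  rewrite (bigD1 i)//= big1 ?addr0 ?mxE ?eqxx ?expr1n// => j ji.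
  by rewrite mxE (negbTE ji) andbF expr0n.
have Ei : E (A i i).
  exists (delta_mx 0 i) => //.
  by rewrite /quad -rowE trmx_delta -colE !mxE.
have Elb : has_lbound E by exists 0 => _ [x _ <-]; exact: Apsd.2.
have Einf : has_inf E by split => //; exists (A i i).
pose r := inf E; have rle x : E x -> r <= x by move=> Ex; exact: ge_inf.
apply: (le_trans _ (rle _ Ei)); apply: lmin.2.
pose B := A - r%:M.
have Bpsd : psd B.
  split; first by rewrite /B linearB/= tr_scalar_mx Apsd.1.
  move=> x; rewrite /B quadB quad_scalar subr_ge0.
  set s := \sum_j _; have s0 : 0 <= s by rewrite sumr_ge0// => j _; exact: sqr_ge0.
  move: (s0); rewrite le_eqVlt => /predU1P[/esym s0'|sp].
    by rewrite s0' mulr0 Apsd.2.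
  have : E (quad A ((Num.sqrt s)^-1 *: x)).
    exists ((Num.sqrt s)^-1 *: x) => //=.
    under eq_bigr do rewrite mxE exprMn exprVn sqr_sqrtr//.
    by rewrite -mulr_sumr mulVf// gt_eqF.
  by move=> /rle; rewrite quadZ exprVn sqr_sqrtr// mulrC ler_pdivlMr// mulrC.
have : B \notin unitmx.
  apply/negP => Bu; have [C C0 HC] := quad_bound (invmx B).
  have Cinv : 0 < C^-1 by rewrite invr_gt0.
  have [_ [x x1 <-]] := inf_adherent Cinv Einf; rewrite -/r.
  apply/negP; rewrite -leNgt.
  (* the point b = s x with the best factor s = 1/C gives B(x) >= 1/C *)
  have := quad_invmx_ge (C^-1 *: x) x Bpsd Bu.
  rewrite quadZ linearZ/= -scalemxAr mxE.
  have -> : (x *m x^T) 0 0 = 1.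
    by rewrite -x1 mxE; apply: eq_bigr => j _; rewrite mxE expr2.
  have : C^-1 ^+ 2 * quad (invmx B) x <= C^-1.
    have qC : C^-1 * quad (invmx B) x <= 1.
      by rewrite mulrC ler_pdivrMr// mul1r HC.
    by rewrite expr2 -mulrA -[leRHS]mulr1 ler_wpM2l// ltW.
  rewrite /B quadB quad_scalar x1 mulr1 mulr1 mulr2n; lra.
rewrite /eigenvalue /eigenspace kermx_eq0 row_free_unit.
by rewrite -/B.
Qed.

End smallest_eigenvalue.
End quadratic_forms.

(** * Independence, joint laws and partial sums *)

Lemma measure_rect_unique d1 d2 (T1 : measurableType d1) (T2 : measurableType d2)
    (R : realType) (m1 m2 : {measure set (T1 * T2) -> \bar R}) :
  (m1 setT < +oo)%E ->
  (forall A B, measurable A -> measurable B -> m1 (A `*` B) = m2 (A `*` B)) ->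
  forall D, measurable D -> m1 D = m2 D.
Proof.
move=> m1oo m12 D mD.
pose G : set (set (T1 * T2)) :=
  [set A `*` B | A in measurable & B in measurable].
apply: (measure_unique G (fun=> setT)) => //.
- exact: measurable_prod_measurableType.
- move=> _ _ [A mA [B mB <-]] [A' mA' [B' mB' <-]].
  exists (A `&` A'); first exact: measurableI.
  by exists (B `&` B'); [exact: measurableI|rewrite setXI].
- by move=> _; exists setT => //; exists setT => //; rewrite setXTT.
- by rewrite bigcup_const.
- by move=> _ [A mA [B mB <-]]; exact: m12.
Qed.

Section independence.
Context d (Omega : measurableType d) (R : realType) (P : probability Omega R).

Lemma measurable_preim d' (T : measurableType d') (f : Omega -> T) A :
  measurable_fun setT f -> measurable A -> measurable (f @^-1` A).
Proof. by move=> mf mA; rewrite -[X in measurable X]setTI; exact: mf. Qed.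

Lemma integral_joint_law d1 d2 (T1 : measurableType d1) (T2 : measurableType d2)
    (U : {mfun Omega >-> T1}) (V : {mfun Omega >-> T2}) (k : T1 * T2 -> \bar R) :
  (forall A B, measurable A -> measurable B ->
    P ((U @^-1` A) `&` (V @^-1` B)) = (P (U @^-1` A) * P (V @^-1` B))%E) ->
  measurable_fun [set: T1 * T2] k ->
  P.-integrable setT (fun w => k (U w, V w)) ->
  (\int[P]_w k (U w, V w) =
   \int[distribution P U]_x \int[distribution P V]_y k (x, y))%E.
Proof.
move=> UV mk ik.
have mUV : measurable_fun setT (fun w => (U w, V w)).
  by apply: measurable_fun_pair.
pose UVm : {mfun Omega >-> (T1 * T2)%type} :=
  mfun_Sub (mem_set mUV : _ \in mfun).
have meq D : measurable D ->
    (distribution P U \x distribution P V)%E D = distribution P UVm D.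
  apply: product_measure_unique => A B mA mB.
  by rewrite /distribution /pushforward /= -(UV _ _ mA mB); congr (P _).
have iK : (distribution P U \x distribution P V)%E.-integrable [set: T1 * T2] k.
  have /integrableP[_ K1] :
    (distribution P UVm).-integrable [set: T1 * T2] k by exact: integrable_pushforward.
  apply/integrableP; split => //.
  by rewrite (eq_measure_integral (distribution P UVm))// => D mD _; exact: meq.
have -> := integral12_prod_meas1 iK.
rewrite -[LHS]/(\int[P]_w (k \o UVm) w)%E -integral_distribution//.
by apply: eq_measure_integral => D mD _; exact/esym/meq.
Qed.

End independence.

Section sums.
Context d (Omega : measurableType d) (R : realType) (P : probability Omega R).

(** Independence of an event from a pair need only be tested on rectangles: both
    sides are finite measures of [D]. *)
Lemma independent_event_pair d1 d2 (T1 : measurableType d1)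
    (T2 : measurableType d2) (U : {mfun Omega >-> T1}) (V : {mfun Omega >-> T2})
    (E : set Omega) : measurable E ->
  (forall A B, measurable A -> measurable B ->
    P ((U @^-1` A) `&` (V @^-1` B) `&` E) =
    (P ((U @^-1` A) `&` (V @^-1` B)) * P E)%E) ->
  forall D : set (T1 * T2), measurable D ->
    P ([set w | D (U w, V w)] `&` E) = (P [set w | D (U w, V w)] * P E)%E.
Proof.
move=> mE UVE D mD.
have mUV : measurable_fun setT (fun w => (U w, V w)).
  by apply: measurable_fun_pair.
pose UVm : {mfun Omega >-> (T1 * T2)%type} :=
  mfun_Sub (mem_set mUV : _ \in mfun).
have PE0 : 0 <= fine (P E) by rewrite fine_ge0.
(* m1' still awaits the measurability proof of UVm *)
pose m1' : {measure set (T1 * T2) -> \bar R} :=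
  pushforward (mrestr P mE) UVm.
pose m1 := m1' mUV.
pose m2 : {measure set (T1 * T2) -> \bar R} := mscale (NngNum PE0) (distribution P UVm).
have PEE : (NngNum PE0)%:num%:E = P E by rewrite /= fineK// fin_num_measure.
have : m1 D = m2 D.
  apply: measure_rect_unique => //.
    rewrite /m1 /m1' /= /pushforward/mrestr.
    by rewrite (le_lt_trans (probability_le1 _ _)) ?ltry// preimage_setT setTI.
  move=> A B mA mB; rewrite /m1 /m1' /m2 /= /mscale PEE /pushforward /mrestr muleC.
  exact: UVE.
by rewrite /m1 /m1' /m2 /= /mscale PEE /pushforward /mrestr muleC.
Qed.

Variables (X : nat -> {mfun Omega >-> R}) (v : R -> R).
Hypotheses (Xind : mutually_independent P X) (mv : measurable_fun setT v).

Let S n w := \sum_(i < n) v (X i w).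

Lemma measurable_partial_sum n : measurable_fun setT (S n).
Proof. by apply: measurable_sum => i; exact: measurableT_comp. Qed.

(** The induction on [n] needs the whole family of later observations: moving
    [X n] into the sum turns independence of [S n] from the events of
    [n :: s] into that of [S n.+1] from the events of [s]. *)
Lemma partial_sum_independent_events n (s : seq nat)
    (B : nat -> set (measurableTypeR R)) (A : set (measurableTypeR R)) :
  uniq s -> (forall i, i \in s -> (n <= i)%N) -> (forall i, measurable (B i)) ->
  measurable A ->
  P ([set w | A (S n w)] `&` \big[setI/setT]_(i <- s) (X i @^-1` B i)) =
  (P [set w | A (S n w)] * P (\big[setI/setT]_(i <- s) (X i @^-1` B i)))%E.
Proof.
elim: n s B A => [|n IH] s B A us ns mB mA.
  under eq_set do rewrite /S big_ord0.
  have [A0|A0] := pselect (A 0).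
    have -> : [set _ : Omega | A 0] = setT by apply/seteqP; split.
    by rewrite setTI probability_setT mul1e.
  have -> : [set _ : Omega | A 0] = set0 by apply/seteqP; split.
  by rewrite set0I measure0 mul0e.
set E := \big[_/_]_(i <- s) _.
have mE : measurable E.
  by apply: bigsetI_measurable => i _; apply: measurable_preim; [|exact: mB].
pose Sn : {mfun Omega >-> R} :=
  mfun_Sub (mem_set (measurable_partial_sum n) : _ \in mfun).
have nns : n \notin s.
  by apply/negP => /ns; rewrite ltnn.
(* B' prescribes C for the observation n and leaves the others unchanged *)
pose B' (C : set (measurableTypeR R)) i := if i == n then C else B i.
have mB' C : measurable C -> forall i, measurable (B' C i).
  by move=> mC i; rewrite /B'; case: ifP.
have EB' C : \big[setI/setT]_(i <- s) (X i @^-1` B' C i) = E.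
  rewrite /E big_seq [RHS]big_seq; apply: eq_bigr => i si.
  by rewrite /B'; case: eqP => // ein; rewrite -ein si in nns.
have B'n C : B' C n = C by rewrite /B' eqxx.
pose D : set (R * R) := [set z | A (z.1 + v z.2)].
have mD : measurable D.
  rewrite -[D]setTI.
  apply: (_ : measurable_fun setT (fun z : R * R => z.1 + v z.2)) => //.
  apply: measurable_funD => //; exact: measurableT_comp.
have := @independent_event_pair _ _ _ _ Sn (X n) E mE _ D mD.
rewrite /D /=.
have SE : S n.+1 = fun w => Sn w + v (X n w).
  by apply/funext => w; rewrite /S big_ord_recr.
rewrite SE; apply => A1 B1 mA1 mB1.
have := IH (n :: s) (B' B1) A1.
rewrite /= nns us big_cons EB' B'n setIA => ->//; last 2 first.
- by move=> i; rewrite inE => /predU1P[->//|/ns/ltnW].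
- exact: mB'.
have := Xind (s := n :: s) (A := B' B1).
rewrite /= nns us !big_cons EB' B'n => ->//; last exact: mB'.
have := IH [:: n] (B' B1) A1.
rewrite !big_seq1 B'n => -> //; last 2 first.
- by move=> i; rewrite inE => /eqP ->.
- exact: mB'.
rewrite muleA; congr (_ * _)%E.
have := Xind us (mB' _ mB1); rewrite EB' => ->.
by [].
Qed.

Lemma partial_sum_independent n :
  independent2 P (S n) (X n).
Proof.
move=> A B mA mB.
have := @partial_sum_independent_events n [:: n] (fun=> B) A.
by rewrite !big_seq1; apply => // i; rewrite inE => /eqP ->.
Qed.

Lemma mutually_independent_pair i j : i != j -> independent2 P (X i) (X j).
Proof.
move=> ij A B mA mB.
have := Xind (s := [:: i; j]) (A := fun k => if k == i then A else B).
rewrite !big_cons !big_nil eqxx (eq_sym j) (negbTE ij) setIT mule1; apply.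
  by rewrite /= inE ij.
by move=> k; case: ifP.
Qed.
End sums.

Lemma law_add_eq d (Omega : measurableType d) d' (Omega' : measurableType d')
    (R : realType) (P : probability Omega R) (P' : probability Omega' R)
    (Y Z : {RV P >-> R}) (Y' Z' : {RV P' >-> R}) :
  independent2 P Y Z -> independent2 P' Y' Z' ->
  (forall A, measurable A -> law P Y A = law P' Y' A) ->
  (forall A, measurable A -> law P Z A = law P' Z' A) ->
  forall A, measurable A -> law P (Y \+ Z) A = law P' (Y' \+ Z') A.
Proof.
move=> YZ YZ' eqY eqZ A mA.
have mp : measurable_fun setT (fun w => (Y w, Z w)).
  by apply: measurable_fun_pair.
have mp' : measurable_fun setT (fun w => (Y' w, Z' w)).
  by apply: measurable_fun_pair.
pose p : {mfun Omega >-> (R * R)%type} := mfun_Sub (mem_set mp : _ \in mfun).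
pose p' : {mfun Omega' >-> (R * R)%type} := mfun_Sub (mem_set mp' : _ \in mfun).
pose D : set (R * R) := [set z | A (z.1 + z.2)].
have mD : measurable D.
  rewrite -[D]setTI.
  apply: (_ : measurable_fun setT (fun z : R * R => z.1 + z.2)) => //.
  exact: measurable_funD.
suff : distribution P p D = distribution P' p' D by [].
apply: measure_rect_unique => //.
  by rewrite /= /distribution /pushforward preimage_setT probability_setT ltry.
move=> A1 B1 mA1 mB1; have := YZ _ _ mA1 mB1; have := YZ' _ _ mA1 mB1.
rewrite /distribution /pushforward /= => E1 E2.
transitivity (P (Y @^-1` A1) * P (Z @^-1` B1))%E; first by rewrite -E2.
have -> : P (Y @^-1` A1) = P' (Y' @^-1` A1) := eqY _ mA1.
have -> : P (Z @^-1` B1) = P' (Z' @^-1` B1) := eqZ _ mB1.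
by rewrite -[LHS]E1.
Qed.

Lemma density_ae_eq (R : realType) (nu : {measure set (measurableTypeR R) -> \bar R})
    (D D' : set (measurableTypeR R) -> \bar R) (f f' : R -> R) :
  has_density nu D f -> has_density nu D' f' -> {ae nu, forall x, f x = f' x} ->
  forall A, measurable A -> D A = D' A.
Proof.
move=> [mf f0 DE] [mf' f0' DE'] ff' A mA; rewrite DE// DE'//.
apply: ae_eq_integral => //.
- by apply/measurable_EFinP; exact: measurable_funTS.
- by apply/measurable_EFinP; exact: measurable_funTS.
- case: ff' => N [mN N0 sub]; exists N; split => // x /= h.
  by apply: sub => /= e; apply: h => _; rewrite e.
Qed.

Lemma integral_eq_law d (T : measurableType d) d' (T' : measurableType d')
    (R : realType) (P : probability T R) (P' : probability T' R)
    (U : {mfun T >-> R}) (U' : {mfun T' >-> R}) (phi : R -> \bar R) :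
  (forall A : set (measurableTypeR R), measurable A ->
    P (U @^-1` A) = P' (U' @^-1` A)) ->
  measurable_fun setT phi ->
  (\int[P]_w phi (U w) = \int[P']_w phi (U' w))%E.
Proof.
move=> UU' mphi.
have ge0 (k : R -> \bar R) : measurable_fun setT k -> (forall x, 0 <= k x)%E ->
    (\int[P]_w k (U w) = \int[P']_w k (U' w))%E.
  move=> mk k0.
  have := ge0_integral_distribution U mk k0.
  have := ge0_integral_distribution U' mk k0.
  rewrite /comp => <- <-; apply: eq_measure_integral => A mA _; exact: UU'.
rewrite integralE [RHS]integralE.
congr (_ - _)%E.
- transitivity (\int[P]_w (phi^\+ (U w)))%E.
    by apply: eq_integral => w _; rewrite !funeposE.
  rewrite (ge0 _ (measurable_funepos mphi) (funepos_ge0 _)).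
  by apply: eq_integral => w _; rewrite !funeposE.
- transitivity (\int[P]_w (phi^\- (U w)))%E.
    by apply: eq_integral => w _; rewrite !funenegE.
  rewrite (ge0 _ (measurable_funeneg mphi) (funeneg_ge0 _)).
  by apply: eq_integral => w _; rewrite !funenegE.
Qed.

Lemma integrable_eq_law d (T : measurableType d) d' (T' : measurableType d')
    (R : realType) (P : probability T R) (P' : probability T' R)
    (U : {mfun T >-> R}) (U' : {mfun T' >-> R}) (phi : R -> \bar R) :
  (forall A : set (measurableTypeR R), measurable A ->
    P (U @^-1` A) = P' (U' @^-1` A)) ->
  measurable_fun setT phi ->
  P'.-integrable setT (phi \o U') -> P.-integrable setT (phi \o U).
Proof.
move=> UU' mphi /integrableP[_ foo]; apply/integrableP; split.
  exact: measurableT_comp.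
rewrite (integral_eq_law (phi := fun x => `|phi x|%E) UU')//.
exact: measurableT_comp.
Qed.

(** * A second-order expansion of the logistic function *)

Section taylor.
Variable R : realType.

(** Integrating a bound on the derivative; applied to successive remainders, this
    gives Taylor's estimate up to a constant factor. *)
Lemma mvt_norm_le (G g : R -> R) (K y : R) :
  (forall u : R, is_derive u 1 G (g u)) -> G 0 = 0 ->
  (forall u, `|u| <= `|y| -> `|g u| <= K) -> `|G y| <= K * `|y|.
Proof.
move=> dG G0 gK.
have cG a b : {within `[a, b], continuous G}.
  by apply: derivable_within_continuous => u _; have [] := dG u.
have [y0|y0|y0] := ltgtP y 0.
- have [c] := MVT y0 (fun u _ => dG u) (cG _ _).
  rewrite in_itv/= G0 !sub0r => /andP[yc c0] /(congr1 Num.norm).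
  rewrite normrN normrM normrN => ->; apply: ler_wpM2r => //.
  by apply: gK; rewrite !ltr0_norm// lerN2 ltW.
- have [c] := MVT y0 (fun u _ => dG u) (cG _ _).
  rewrite in_itv/= G0 !subr0 => /andP[c0 cy] /(congr1 Num.norm).
  rewrite normrM => ->; apply: ler_wpM2r => //.
  by apply: gK; rewrite !gtr0_norm// ltW.
- by rewrite y0 G0 normr0 mulr0.
Qed.

Lemma is_derive_translate (f f' : R -> R) (x u : R) :
  (forall u : R, is_derive u 1 f (f' u)) ->
  is_derive u 1 (fun v => f (x + v)) (f' (x + u)).
Proof.
move=> df; have -> : (fun v => f (x + v)) = f \o (cst x \+ id) by [].
by apply: is_derive_eq; rewrite add0r mulr1.
Qed.

(** The bound [y ^ 2] serves for large [y], the bound [|y| ^ 3] for small [y]: only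
    their minimum is integrable with an integral of smaller order than the
    variance when the third moment may be infinite. *)
Lemma taylor2_le (f f1 f2 f3 : R -> R) (M : R) :
  (forall x : R, is_derive x 1 f (f1 x)) -> (forall x : R, is_derive x 1 f1 (f2 x)) ->
  (forall x : R, is_derive x 1 f2 (f3 x)) ->
  (forall x, `|f2 x| <= M) -> (forall x, `|f3 x| <= M) ->
  forall x y, `|f (x + y) - f x - y * f1 x - y ^+ 2 * (f2 x / 2)| <=
    M *+ 2 * Num.min (y ^+ 2) (`|y| ^+ 3).
Proof.
move=> df df1 df2 M2 M3 x y; have M0 : 0 <= M by exact: le_trans (M2 0).
have d0 (u : R) : is_derive u 1 (fun v => f (x + v)) (f1 (x + u)).
  exact: is_derive_translate.
have d1 (u : R) : is_derive u 1 (fun v => f1 (x + v)) (f2 (x + u)).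
  exact: is_derive_translate.
have d2 (u : R) : is_derive u 1 (fun v => f2 (x + v)) (f3 (x + u)).
  exact: is_derive_translate.
pose r2 u := f2 (x + u) - f2 x.
pose r1 u := f1 (x + u) - f1 x - u * f2 x.
pose r0 u := f (x + u) - f x - u * f1 x - u ^+ 2 * (f2 x / 2).
have dr2 (u : R) : is_derive u 1 r2 (f3 (x + u)).
  have -> : r2 = (fun v => f2 (x + v)) - cst (f2 x) by [].
  by apply: is_derive_eq; rewrite subr0.
have dr1 (u : R) : is_derive u 1 r1 (r2 u).
  have -> : r1 = (fun v => f1 (x + v)) - cst (f1 x) - id * cst (f2 x) by [].
  by apply: is_derive_eq; rewrite scaler0 add0r /GRing.scale/= mulr1 subr0.
have dr0 (u : R) : is_derive u 1 r0 (r1 u).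
  have -> : r0 = (fun v => f (x + v)) - cst (f x) - id * cst (f1 x)
      - (id * id) * cst (f2 x / 2) by [].
  apply: is_derive_eq; rewrite !scaler0 !add0r /GRing.scale/= !mulr1 subr0.
  by rewrite /r1; congr (_ - _); rewrite /cst; field.
have r20 : r2 0 = 0 by rewrite /r2 addr0 subrr.
have r10 : r1 0 = 0 by rewrite /r1 addr0 subrr mul0r subr0.
have r00 : r0 0 = 0 by rewrite /r0 addr0 subrr !(mul0r, expr0n, subr0).
have b2 u : `|r2 u| <= M * `|u| by exact: (mvt_norm_le dr2).
have b2' u : `|r2 u| <= M *+ 2.
  by rewrite mulr2n (le_trans (ler_normB _ _))// lerD.
have b1 u : `|r1 u| <= M * `|u| * `|u|.
  apply: (mvt_norm_le dr1) => // z zu; apply: (le_trans (b2 z)).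
  exact: ler_wpM2l.
have b1' u : `|r1 u| <= M *+ 2 * `|u|.
  by apply: (mvt_norm_le dr1) => // z zu; exact: b2'.
rewrite -/(r0 y) minEle; case: ifP => _.
  rewrite -[y ^+ 2]real_normK ?num_real// expr2 mulrA.
  apply: (mvt_norm_le dr0) => // z zu; apply: (le_trans (b1' z)).
  by apply: ler_wpM2l => //; rewrite mulrn_wge0.
have -> : M *+ 2 * `|y| ^+ 3 = (M *+ 2 * `|y| * `|y|) * `|y|.
  by rewrite !exprS expr0; ring.
apply: (mvt_norm_le dr0) => // z zu; apply: (le_trans (b1 z)).
rewrite -!mulrA; apply: ler_pM; rewrite ?mulr_ge0//; first by rewrite mulr2n lerDl.
by apply: ler_pM.
Qed.

Definition logistic (x : R) : R := (1 + expR x)^-1.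

Lemma logistic_ge0 x : 0 <= logistic x.
Proof. by rewrite invr_ge0 addr_ge0// expR_ge0. Qed.

Lemma logistic_le1 x : logistic x <= 1.
Proof. by rewrite invf_le1 ?ltr_pwDl ?expR_ge0// lerDl expR_ge0. Qed.

Lemma logistic_is_derive (x : R) :
  is_derive x 1 logistic (logistic x ^+ 2 - logistic x).
Proof.
have e0 : (cst 1 + @expR R) x != 0 by rewrite gt_eqF// ltr_pwDl// expR_ge0.
have d1 : is_derive x 1 (cst 1 + @expR R) (expR x).
  by apply: is_derive_eq; rewrite add0r.
have := is_deriveV e0 d1.
rewrite (_ : (fun _ => _) = logistic)// => /is_derive_eq; apply.
by rewrite /logistic /GRing.scale/= -[(cst 1 + @expR R) x]/(1 + expR x); field.
Qed.

(** As [s' = s ^ 2 - s], every derivative of the logistic function [s] is a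
    polynomial in [s], hence bounded. *)
Lemma logistic_taylor : exists p1 p2 : R -> R,
  forall x y, `|logistic (x + y) - logistic x - y * p1 x - y ^+ 2 * (p2 x / 2)|
    <= 2 * Num.min (y ^+ 2) (`|y| ^+ 3).
Proof.
pose s := logistic; pose s1 : R -> R := s * s - s.
pose s2 : R -> R := (s + s) * s1 - s1.
pose s3 : R -> R := (s + s) * s2 + s1 * (s1 + s1) - s2.
have ds (x : R) : is_derive x 1 s (s1 x).
  by have := logistic_is_derive x; rewrite expr2.
have ds1 (x : R) : is_derive x 1 s1 (s2 x).
  by apply: is_derive_eq; rewrite /s2 /GRing.scale/= !fctE; ring.
have ds2 (x : R) : is_derive x 1 s2 (s3 x).
  by apply: is_derive_eq; rewrite /s3 /GRing.scale/= !fctE; ring.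
exists s1, s2.
apply: (taylor2_le ds ds1 ds2) => x.
  rewrite ler_norml /s2 /s1 !fctE; have := logistic_ge0 x; have := logistic_le1 x.
  by rewrite -/s; move: (s x) => t; nra.
rewrite ler_norml /s3 /s2 /s1 !fctE; have := logistic_ge0 x; have := logistic_le1 x.
rewrite -/s; move: (s x) => t t1 t0.
have q0 : t * t - t <= 0 by nra.
have q1 : - 1 <= 4 * (t * t - t) by have := sqr_ge0 (t - 2^-1); rewrite expr2; lra.
have qq : (t * t - t) * (t * t - t) <= 4^-1 * 4^-1 by nra.
by apply/andP; split; nra.
Qed.

Lemma continuous_logistic : continuous logistic.
Proof.
move=> x; apply: differentiable_continuous; apply/derivable1_diffP.
by have [] := logistic_is_derive x.
Qed.
End taylor.

(** * The standard Gaussian law *)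

Section density.
Local Open Scope ereal_scope.
Context d (T : measurableType d) (R : realType).
Variables (mu nu : {measure set T -> \bar R}) (p : T -> R).
Hypotheses (mp : measurable_fun setT p) (p0 : forall x, (0 <= p x)%R).
Hypothesis nuE : forall A, measurable A -> nu A = \int[mu]_(x in A) (p x)%:E.

Import HBNNSimple.

Let nnsfunE (f : {nnsfun T >-> R}) :
  \int[nu]_x (f x)%:E = \int[mu]_x ((f x)%:E * (p x)%:E).
Proof.
have mpE : measurable_fun setT (EFin \o p) by exact/measurable_EFinP.
under [LHS]eq_integral do rewrite fimfunE -fsumEFin//.
rewrite [LHS]ge0_integral_fsum//; last 2 first.
  - by move=> r; exact/measurable_EFinP/measurableT_comp.
  - by move=> n x _; rewrite EFinM nnfun_muleindic_ge0.
under [RHS]eq_integral.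
  move=> x xD; rewrite fimfunE -fsumEFin// ge0_mule_fsuml; last first.
    by move=> r; rewrite EFinM nnfun_muleindic_ge0.
  over.
rewrite [RHS]ge0_integral_fsum//; last 2 first.
  - move=> r; apply: emeasurable_funM => //.
    exact/measurable_EFinP/measurableT_comp.
  - by move=> n x _; rewrite mule_ge0 ?lee_fin ?p0// -lee_fin EFinM nnfun_muleindic_ge0.
apply: eq_fsbigr => r _.
rewrite integralZl_indic_nnsfun//= integral_indic//= setIT nuE//.
have [r0|r0] := ltP r 0%R.
  rewrite preimage_nnfun0// integral_set0 mule0.
  by rewrite integral0_eq// => x _; rewrite indic0 mulr0 mul0e.
transitivity (\int[mu]_x (r%:E * ((\1_(f @^-1` [set r]) x)%:E * (p x)%:E))); last first.
  by apply: eq_integral => x _; rewrite muleA.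
rewrite ge0_integralZl//; last 2 first.
  - by apply: emeasurable_funM => //; exact/measurable_EFinP.
  - by move=> x _; rewrite mule_ge0// lee_fin ?p0.
congr (_ * _); rewrite integral_mkcond; apply: eq_integral => x _.
by rewrite patchE indicE; case: ifPn => _; rewrite ?mul1e ?mul0e.
Qed.

Lemma ge0_integral_density (f : T -> \bar R) :
  measurable_fun setT f -> (forall x, 0 <= f x) ->
  \int[nu]_x f x = \int[mu]_x (f x * (p x)%:E).
Proof.
move=> mf f0; pose f_ := nnsfun_approx measurableT mf.
transitivity (lim (\int[nu]_x (f_ n x)%:E @[n --> \oo])).
  rewrite -monotone_convergence//=.
  - apply: eq_integral => ? /[!inE] xD; apply/esym/cvg_lim => //=.
    exact: cvg_nnsfun_approx.
  - by move=> n; exact/measurable_EFinP/measurable_funTS.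
  - by move=> n ? _; rewrite lee_fin.
  - by move=> ? _ ? ? mn; rewrite lee_fin; exact/lefP/nd_nnsfun_approx.
transitivity (lim (\int[mu]_x ((f_ n x)%:E * (p x)%:E) @[n --> \oo])).
  by apply: congr_lim; apply/funext => n /=; exact: nnsfunE.
rewrite -monotone_convergence//=.
- apply: eq_integral => x _; apply/cvg_lim => //=.
  by apply: cvgeZr => //; exact: cvg_nnsfun_approx.
- move=> n; apply: emeasurable_funM; first exact/measurable_EFinP/measurable_funTS.
  exact/measurable_EFinP.
- by move=> n x _; rewrite mule_ge0// lee_fin ?p0.
- move=> x _ m n mn; rewrite lee_wpmul2r ?lee_fin ?p0//.
  exact/lefP/nd_nnsfun_approx.
Qed.
End density.

Section lebesgue_affine.
Context {R : realType}.
Local Notation leb := (@lebesgue_measure R).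

Lemma ge0_integral_affine (G : R -> R) (a b : R) : 0 < a ->
  continuous G -> (forall x, 0 <= G x) ->
  (\int[leb]_x (G x)%:E = \int[leb]_x (G (a * x + b) * a)%:E)%E.
Proof.
move=> a0 cG G0; pose F : R -> R := fun x => a * x + b.
have dF (x : R) : is_derive x 1 F a.
  have -> : F = cst a * id + cst b by [].
  by apply: is_derive_eq; rewrite scaler0 !addr0 /GRing.scale/= mulr1.
have F' : F^`()%classic = cst a.
  by apply/funext => x; rewrite derive1E; have [_ ->] := dF x.
rewrite (@increasing_ge0_integration_by_substitutionT _ F G)//.
- by rewrite F'.
- by move=> x y xy; rewrite /F ltrD2r ltr_pM2l.
- by rewrite F'; exact: cst_continuous.
- by rewrite F'; exact: is_cvg_cst.
- by rewrite F'; exact: is_cvg_cst.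
- apply: (cvg_comp (fun x => a * x) (fun x => x + b)); last exact: cvg_addrr_Ny.
  exact: (gt0_cvgMrNy a0 cvg_id).
- apply: (cvg_comp (fun x => a * x) (fun x => x + b)); last exact: cvg_addrr.
  exact: (gt0_cvgMry a0 cvg_id).
Qed.

End lebesgue_affine.

Section gaussian.
Variable R : realType.
Local Notation leb := (@lebesgue_measure R).
Local Notation N01 := (normal_prob (0 : R) 1).
Local Notation gauss := (normal_pdf (0 : R) 1).
Local Notation gc := (normal_peak (1 : R)).

Lemma gaussE x : gauss x = gc * expR (- (x ^+ 2 / 2)).
Proof.
by rewrite normal_pdfE ?oner_eq0// /normal_fun subr0 expr1n mulNr.
Qed.

Lemma normal_peak1_gt0 : 0 < gc. Proof. exact/normal_peak_gt0/oner_neq0. Qed.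

Lemma continuous_gauss : continuous gauss.
Proof. exact/continuous_normal_pdf/oner_neq0. Qed.

(** Rotation invariance of the planar Gaussian density, in the coordinates
    [y] and [u = (s y + t z) / r], where [z] is the second coordinate and the
    rotated companion of [u] is [(r y - s u) / t]. *)
Lemma gauss_rotate (s t r y u : R) : 0 < s -> 0 < t -> r ^+ 2 = s ^+ 2 + t ^+ 2 ->
  gauss y * gauss ((r * u - s * y) / t) = gauss u * gauss ((r * y - s * u) / t).
Proof.
move=> s0 t0 rE; rewrite !gaussE -![gc * _ * (gc * _)]mulrACA -!expRD.
congr (_ * expR _); have t1 : t != 0 by rewrite gt_eqF.
apply: (mulfI (mulf_neq0 t1 t1)).
have E z : t * t * ((z / t) ^+ 2 / 2) = z ^+ 2 / 2 by field.
rewrite !mulrDr !mulrN !E.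
have := rE; rewrite !expr2 => rE'; rewrite !mulrBl !mulrBr.
have -> : r * u * (r * u) = (r * r) * (u * u) by ring.
have -> : r * y * (r * y) = (r * r) * (y * y) by ring.
by rewrite rE'; field.
Qed.

Lemma ge0_integral_gauss (f : R -> \bar R) : measurable_fun setT f ->
  (forall x, 0 <= f x)%E ->
  (\int[N01]_x f x = \int[leb]_x (f x * (gauss x)%:E))%E.
Proof.
move=> mf f0; apply: ge0_integral_density => //.
- exact: measurable_normal_pdf.
- by move=> x; exact: normal_pdf_ge0.
Qed.

(** [s Y + t Z] has the law of [r U] for independent standard Gaussian [Y], [Z],
    [U] when [r ^ 2 = s ^ 2 + t ^ 2].  For fixed [y] substitute
    [u = (s y + t z) / r]; after exchanging the integrals, [gauss_rotate] factors
    the integrand and the integral over [y] is that of a density. *)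
Lemma gaussian_semigroup (phi : R -> R) (s t r x : R) :
  continuous phi -> (forall y, 0 <= phi y) ->
  0 < s -> 0 < t -> 0 < r -> r ^+ 2 = s ^+ 2 + t ^+ 2 ->
  (\int[N01]_y \int[N01]_z (phi (x + s * y + t * z))%:E =
   \int[N01]_u (phi (x + r * u))%:E)%E.
Proof.
move=> cphi phi0 s0 t0 r0 rE.
have mphi : measurable_fun setT phi by exact: continuous_measurable_fun.
have mg : measurable_fun setT gauss by exact: measurable_normal_pdf.
have t1 : t != 0 by rewrite gt_eqF.
have r1 : r != 0 by rewrite gt_eqF.
have rt0 : 0 < r / t by rewrite divr_gt0.
have g0 z : 0 <= gauss z by exact: normal_pdf_ge0.
have cgauss := continuous_gauss.
have caff (a b : R) : continuous (fun z => a + b * z).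
  by move=> z; apply: cvgD; [exact: cvg_cst|apply: cvgM; [exact: cvg_cst|]].
have mpa a b : measurable_fun [set: R] (fun z : R => (phi (a + b * z))%:E).
  apply/measurable_EFinP; apply: measurableT_comp => //.
  by apply: measurable_funD => //; exact: measurable_funM.
have pe0 a b z : (0 <= (phi (a + b * z))%:E)%E by rewrite lee_fin.
have mki y : measurable_fun [set: R]
    (fun u : R => (phi (x + r * u) * (gauss ((r * u - s * y) / t) * (r / t)))%:E).
  apply/measurable_EFinP; apply: measurable_funM.
    by apply/measurable_EFinP; exact: mpa.
  apply: measurable_funM => //; apply: measurableT_comp => //.
  apply: measurable_funM => //.
  by apply: measurable_funB => //; exact: measurable_funM.
have inner y : (\int[N01]_z (phi (x + s * y + t * z))%:E =
    \int[leb]_u (phi (x + r * u) * (gauss ((r * u - s * y) / t) * (r / t)))%:E)%E.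
  rewrite (ge0_integral_gauss (mpa _ _) (pe0 _ _)).
  under eq_integral do rewrite -EFinM.
  rewrite (@ge0_integral_affine _ (fun z => phi (x + s * y + t * z) * gauss z)
    (r / t) (- (s * y / t)))//; last 2 first.
  - move=> z; apply: cvgM; last exact: cgauss.
    exact: (cvg_comp _ phi (caff _ _ z) (cphi _)).
  - by move=> z; rewrite mulr_ge0.
  apply: eq_integral => u _; rewrite -mulrA; congr ((phi _ * (gauss _ * _))%:E).
    by field.
  by field.
pose k (z : R * R) : \bar R := ((phi (x + r * z.2) *
  (gauss ((r * z.2 - s * z.1) / t) * (r / t))) * gauss z.1)%:E.
have mk : measurable_fun setT k.
  apply/measurable_EFinP; apply: measurable_funM; last exact: measurableT_comp.
  apply: measurable_funM.
    apply: measurableT_comp => //; apply: measurable_funD => //.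
    exact: measurable_funM.
  apply: measurable_funM => //; apply: measurableT_comp => //.
  apply: measurable_funM => //.
  by apply: measurable_funB => //; exact: measurable_funM.
have k0 z : (0 <= k z)%E by rewrite lee_fin !mulr_ge0// ltW// invr_gt0.
transitivity (\int[leb]_y \int[leb]_u k (y, u))%E.
  have mi : measurable_fun setT (fun y =>
      \int[leb]_u (phi (x + r * u) * (gauss ((r * u - s * y) / t) * (r / t)))%:E)%E.
    pose k' (z : R * R) : \bar R := (phi (x + r * z.2) *
      (gauss ((r * z.2 - s * z.1) / t) * (r / t)))%:E.
    have mk' : measurable_fun setT k'.
      apply/measurable_EFinP; apply: measurable_funM.
        apply: measurableT_comp => //; apply: measurable_funD => //.
        exact: measurable_funM.
      apply: measurable_funM => //; apply: measurableT_comp => //.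
      apply: measurable_funM => //.
      by apply: measurable_funB => //; exact: measurable_funM.
    have k'0 z : (0 <= k' z)%E by rewrite lee_fin !mulr_ge0// ltW// invr_gt0.
    by have := @measurable_fun_fubini_tonelli_F _ _ _ _ _ leb k' mk' k'0.
  under eq_integral do rewrite inner.
  rewrite ge0_integral_gauss//; last first.
    by move=> y; apply: integral_ge0 => u _; rewrite lee_fin !mulr_ge0// ltW// invr_gt0.
  apply: eq_integral => y _; rewrite -ge0_integralZr//.
  - exact: mki.
  - by move=> u _; rewrite lee_fin !mulr_ge0// ltW// invr_gt0.
  - by rewrite lee_fin.
rewrite (@fubini_tonelli _ _ (measurableTypeR R) (measurableTypeR R) R leb leb k mk k0).
rewrite (ge0_integral_gauss (mpa _ _) (pe0 _ _)).
apply: eq_integral => u _.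
transitivity (\int[leb]_y ((phi (x + r * u) * gauss u)%:E *
    (gauss (r / t * y + - (s * u / t)) * (r / t))%:E))%E.
  apply: eq_integral => y _; rewrite /k /= -EFinM; congr EFin.
  have -> : r / t * y + - (s * u / t) = (r * y - s * u) / t by field.
  rewrite -!mulrA; congr (_ * _).
  rewrite [RHS]mulrA -(gauss_rotate y u s0 t0 rE) -!mulrA; ring.
rewrite ge0_integralZl//=.
- by rewrite -ge0_integral_affine// integral_normal_pdf mule1.
- apply/measurable_EFinP; apply: measurable_funM => //; apply: measurableT_comp => //.
  by apply: measurable_funD => //; exact: measurable_funM.
- by move=> y _; rewrite lee_fin mulr_ge0// ltW.
- by rewrite lee_fin mulr_ge0.
Qed.
End gaussian.

Section gaussian_moments.
Variable R : realType.
Local Notation leb := (@lebesgue_measure R).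
Local Notation N01 := (normal_prob (0 : R) 1).
Local Notation gauss := (normal_pdf (0 : R) 1).

Lemma is_derive_gauss (x : R) : is_derive x 1 gauss (- x * gauss x).
Proof.
have -> : gauss = cst (normal_peak 1) * (expR \o (id * id * cst (- 2^-1))).
  apply/funext => y; rewrite gaussE; congr (_ * expR _).
  by rewrite /= expr2 mulrN.
by apply: is_derive_eq; rewrite !fctE /GRing.scale/=; field.
Qed.

Lemma cvg_mulx_gauss : x * gauss x @[x --> +oo%R] --> (0 : R).
Proof.
have c0 := @normal_peak1_gt0 R.
apply: (@squeeze_cvgr _ _ _ _ (cst 0) (fun x => (normal_peak 1 *+ 2) * x^-1)).
- near=> x; have x0 : 0 < x by near: x; exact: nbhs_pinfty_gt.
  apply/andP; split; first by rewrite mulr_ge0 ?normal_pdf_ge0// ltW.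
  rewrite /= gaussE.
  have : expR (- (x ^+ 2 / 2)) <= 2 / x ^+ 2.
    rewrite expRN -[2 / _]invf_div lef_pV2 ?posrE ?expR_gt0 ?divr_gt0 ?exprn_gt0//.
    by rewrite (le_trans _ (expR_ge1Dx _))// lerDr.
  move=> /(ler_wpM2l (ltW (mulr_gt0 x0 c0))) h.
  rewrite mulrA; apply: (le_trans h).
  by rewrite le_eqVlt; apply/orP; left; apply/eqP; field; rewrite gt_eqF.
- exact: cvg_cst.
- rewrite -[X in _ --> X](mulr0 (normal_peak 1 *+ 2)).
  apply: cvgM; first exact: cvg_cst.
  apply/gtr0_cvgV0; last exact: cvg_id.
  by near=> x; near: x; exact: nbhs_pinfty_gt.
Unshelve. all: by end_near. Qed.

Let g0 z : 0 <= gauss z. Proof. exact: normal_pdf_ge0. Qed.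
Let mg : measurable_fun [set: R] gauss. Proof. exact: measurable_normal_pdf. Qed.

Let csqr (h : R -> R) : continuous h -> continuous (fun x : R => h x * gauss x).
Proof. by move=> ch x; apply: cvgM; [exact: ch|exact: continuous_gauss]. Qed.

Let cpoly (a b : R) : continuous (fun x : R => (a * (x * x) + b) * gauss x).
Proof.
apply: (csqr (h := fun x : R => a * (x * x) + b)) => x.
apply: cvgD; last exact: cvg_cst.
by apply: cvgM; [exact: cvg_cst|exact: cvgM].
Qed.

Let msqr : measurable_fun [set: R] (fun x : R => (x * x * gauss x)%:E).
Proof.
by apply/measurable_EFinP; apply: measurable_funM => //; exact: measurable_funM.
Qed.

Let dxg (x : R) : is_derive x 1 (id * gauss) (((-1) * (x * x) + 1) * gauss x).
Proof.
have h := is_derive_gauss x.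
by apply: is_derive_eq; rewrite /GRing.scale/=; ring.
Qed.

Let dxg1 : (id * gauss)^`()%classic = (fun x : R => ((-1) * (x * x) + 1) * gauss x).
Proof. by apply/funext => x; rewrite derive1E; have [_ ->] := dxg x. Qed.

(** The second moment compares [x ^ 2 gauss x] with [gauss x], whose difference is
    the derivative of [x gauss x] up to sign.  The sign of [1 - x ^ 2] changes at
    1, so the half line is capped_sqr there; the boundary terms [gauss 1] cancel. *)
Let below1 : (\int[leb]_(x in `[0%R, 1%R]) (gauss x)%:E =
  \int[leb]_(x in `[0%R, 1%R]) (x * x * gauss x)%:E + (gauss 1)%:E)%E.
Proof.
have -> : (gauss 1)%:E =
    (\int[leb]_(x in `[0%R, 1%R]) (((-1) * (x * x) + 1) * gauss x)%:E)%E.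
  rewrite (@continuous_FTC2 _ _ (id * gauss))//.
  - by rewrite !fctE mul1r mul0r sube0.
  - exact: continuous_subspaceT.
  - have cF : continuous (id * gauss : R -> R) by apply: csqr => x; exact: cvg_id.
    split.
    + by move=> x _; have [] := dxg x.
    + exact/cvg_at_right_filter/cF.
    + exact/cvg_at_left_filter/cF.
  - by move=> x _; rewrite dxg1.
rewrite -ge0_integralD//=.
- by apply: eq_integral => x _; rewrite -EFinD; congr EFin; ring.
- by move=> x _; rewrite lee_fin mulr_ge0// -expr2 sqr_ge0.
- exact: measurable_funTS.
- move=> x; rewrite in_itv/= => /andP[x0 x1]; rewrite lee_fin mulr_ge0//.
  by rewrite mulN1r addrC subr_ge0 mulr_ile1.
- apply/measurable_EFinP/measurable_funTS; exact: continuous_measurable_fun.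
Qed.

Let above1 : (\int[leb]_(x in `[1%R, +oo[) (x * x * gauss x)%:E =
  \int[leb]_(x in `[1%R, +oo[) (gauss x)%:E + (gauss 1)%:E)%E.
Proof.
have -> : (gauss 1)%:E =
    (\int[leb]_(x in `[1%R, +oo[) ((1 * (x * x) + (-1)) * gauss x)%:E)%E.
  have cF : continuous (- (id * gauss) : R -> R).
    by move=> x; apply: cvgN; apply: csqr => y; exact: cvg_id.
  rewrite (@ge0_continuous_FTC2y _ _ (- (id * gauss)) _ 0)//.
  - by rewrite !fctE mul1r EFinN oppeK add0e.
  - move=> x x1; rewrite mulr_ge0// mul1r subr_ge0.
    by rewrite -[leLHS]mulr1 ler_pM.
  - exact: continuous_subspaceT.
  - by have := cvgN cvg_mulx_gauss; rewrite oppr0; exact.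
  - by move=> x _; apply: derivableN; have [] := dxg x.
  - exact/cvg_at_right_filter/cF.
  - move=> x _; rewrite derive1E deriveN; last by have [] := dxg x.
    by have [_ ->] := dxg x; ring.
rewrite -ge0_integralD//=.
- by apply: eq_integral => x _; rewrite -EFinD; congr EFin; ring.
- by move=> x _; rewrite lee_fin.
- by apply/measurable_EFinP; exact: measurable_funTS.
- move=> x; rewrite in_itv/= andbT => x1; rewrite lee_fin mulr_ge0// mul1r subr_ge0.
  by rewrite -[leLHS]mulr1 ler_pM.
- apply/measurable_EFinP/measurable_funTS; exact: continuous_measurable_fun.
Qed.

Let split1 (f : R -> \bar R) : measurable_fun [set: R] f -> (forall x, 0 <= f x)%E ->
  (\int[leb]_(x in [set x : R | (0 <= x)%R]) f x =
   \int[leb]_(x in `[0%R, 1%R]) f x + \int[leb]_(x in `[1%R, +oo[) f x)%E.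
Proof.
move=> mf f0.
rewrite -[X in (_ + X)%E]integral_itv_obnd_cbnd; last exact: measurable_funTS.
rewrite -ge0_integral_setU//=.
- congr (integral _ _ _); apply/seteqP; split => x /=; rewrite !in_itv/= ?andbT.
    by move=> x0; case: (leP x 1) => x1; [left; rewrite x0|right].
  by case=> [/andP[]//|/ltW]; exact: le_trans.
- exact: measurable_funTS.
- apply/disj_setPS => x [] /=; rewrite !in_itv/= andbT => /andP[_ x1].
  by rewrite ltNge x1.
Qed.

Lemma gaussian_second_moment : (\int[N01]_x (x ^+ 2)%:E = 1)%E.
Proof.
rewrite ge0_integral_gauss; last 2 first.
- by apply/measurable_EFinP; exact: measurable_funX.
- by move=> x; rewrite lee_fin sqr_ge0.
transitivity (\int[leb]_x (x * x * gauss x)%:E)%E.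
  by apply: eq_integral => x _; rewrite -EFinM expr2.
rewrite -(integral_normal_pdf 0 (1 : R)).
have even_g y : gauss (- y) = gauss y by rewrite !gaussE sqrrN.
rewrite !ge0_symfun_integralT//; last 5 first.
- exact: continuous_gauss.
- by move=> x; rewrite /= even_g.
- by move=> x; rewrite mulr_ge0// -expr2 sqr_ge0.
- by apply: csqr => x; exact: cvgM.
- by move=> x; rewrite /= even_g mulrNN.
congr (_ * _)%E; rewrite !split1//; last 2 first.
- exact/measurable_EFinP.
- by move=> x; rewrite lee_fin mulr_ge0// -expr2 sqr_ge0.
by rewrite above1 below1 -addeA [X in (_ + X)%E]addeC.
Qed.

Lemma gaussian_symmetric (f : R -> \bar R) : measurable_fun [set: R] f ->
  (forall x, 0 <= f x)%E -> (\int[N01]_x f x = \int[N01]_x f (- x)%R)%E.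
Proof.
move=> mf f0; have mN : measurable_fun [set: R] (fun x : R => f (- x)).
  exact: measurableT_comp.
rewrite !ge0_integral_gauss//.
pose k x := (f x * (gauss x)%:E)%E.
transitivity (\int[pushforward leb (-%R : R -> measurableTypeR R)]_x k x)%E.
  apply: eq_measure_integral => A mA _; exact/esym/lebesgue_measureN.
have mk : measurable_fun [set: R] k.
  by apply: emeasurable_funM => //; exact/measurable_EFinP.
rewrite ge0_integral_pushforward//; last first.
  by move=> x _; rewrite mule_ge0// lee_fin.
by apply: eq_integral => x _; rewrite /k /= !gaussE sqrrN.
Qed.

Lemma gaussian_mean : (\int[N01]_x x%:E = 0)%E.
Proof.
rewrite integralE.
have mf : measurable_fun [set: R] (fun x : R => x%:E).
  by apply/measurable_EFinP; exact: measurable_id.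
rewrite [X in (_ - X)%E]gaussian_symmetric//; last exact: measurable_funeneg.
have -> : (\int[N01]_x (fun x : R => x%:E)^\- (- x)%R =
           \int[N01]_x (fun x : R => x%:E)^\+ x)%E.
  by apply: eq_integral => x _; rewrite funenegE funeposE EFinN oppeK.
rewrite subee// ge0_fin_numE; last by apply: integral_ge0 => x _; exact: funepos_ge0.
apply: (@le_lt_trans _ _ (\int[N01]_x (1 + (x ^+ 2)%:E)))%E.
  apply: ge0_le_integral => //.
  - exact: (@measurable_funepos _ _ R setT _ mf).
  - apply: emeasurable_funD => //; apply/measurable_EFinP; exact: measurable_funX.
  - move=> x _; rewrite funeposE -EFin_max -EFinD lee_fin ge_max.
    rewrite addr_ge0 ?sqr_ge0// andbT.
    by have := sqr_ge0 (x - 2^-1); rewrite !expr2; lra.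
rewrite ge0_integralD//=.
- by rewrite gaussian_second_moment integral_cst//= probability_setT mul1e ltry.
- by move=> x _; rewrite lee_fin sqr_ge0.
- apply/measurable_EFinP; exact: measurable_funX.
Qed.
End gaussian_moments.

(** * The central limit theorem by comparison of averaging operators *)

Section averaging.
Variable R : realType.
Implicit Types (F G : probability (measurableTypeR R) R) (phi : R -> R).

(** The averaging operator of [F] at scale [t]: the function
    [x |-> E phi(x + t V)] for [V] of law [F]. *)
Definition shift_mean F (t : R) phi (x : R) : R := \int[F]_y phi (x + t * y).

(** A class of test functions that is stable under averaging and on which all
    integrals are finite. *)
Definition unit_fun phi := measurable_fun [set: R] phi /\ forall x, 0 <= phi x <= 1.

Lemma unit_fun_integrable d (T : measurableType d) (P : probability T R)
    (f : T -> R) : measurable_fun setT f -> (forall x, 0 <= f x <= 1) ->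
  P.-integrable setT (EFin \o f).
Proof.
move=> mf f01; apply: measurable_bounded_integrable => //.
  by have : (P setT < +oo)%E by rewrite probability_setT ltry.
exists 1; split => // M M1 x _ /=; have /andP[f0 f1] := f01 x.
by rewrite ger0_norm// (le_trans f1)// ltW.
Qed.

Lemma measurable_shift phi (t x : R) : measurable_fun [set: R] phi ->
  measurable_fun [set: R] (fun y => phi (x + t * y)).
Proof.
move=> mphi; apply: measurableT_comp => //.
by apply: measurable_funD => //; exact: measurable_funM.
Qed.

Lemma integrable_shift F phi (t x : R) : unit_fun phi ->
  F.-integrable setT (fun y => (phi (x + t * y))%:E).
Proof.
by move=> [mphi phi01]; apply: unit_fun_integrable; [exact: measurable_shift|].
Qed.

Lemma shift_mean_EFin F t phi x : unit_fun phi ->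
  ((shift_mean F t phi x)%:E = \int[F]_y (phi (x + t * y))%:E)%E.
Proof.
move=> uphi; rewrite fineK//; apply: integrable_fin_num => //.
exact: integrable_shift.
Qed.

Lemma unit_fun_shift_mean F t phi : unit_fun phi -> unit_fun (shift_mean F t phi).
Proof.
move=> uphi; have [mphi phi01] := uphi; split.
  apply: (measurableT_comp (f := @fine R)) => //.
  pose k (z : R * R) := (phi (z.1 + t * z.2))%:E.
  have mk : measurable_fun [set: R * R] k.
    apply/measurable_EFinP; apply: measurableT_comp => //.
    by apply: measurable_funD => //; exact: measurable_funM.
  have k0 z : (0 <= k z)%E by rewrite lee_fin; case/andP: (phi01 (z.1 + t * z.2)).
  by have := @measurable_fun_fubini_tonelli_F _ _ (measurableTypeR R)
    (measurableTypeR R) _ F k mk k0.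
move=> x; apply/andP; split.
  by apply: Rintegral_ge0 => y _; case/andP: (phi01 (x + t * y)).
have -> : 1 = \int[F]_y (1 : R).
  by rewrite Rintegral_cst//= probability_setT mul1r.
apply: le_Rintegral => //.
- exact: integrable_shift.
- by apply: unit_fun_integrable => // _; rewrite lexx ler01.
- by move=> y _; case/andP: (phi01 (x + t * y)).
Qed.

Lemma unit_fun_iter F t phi n : unit_fun phi -> unit_fun (iter n (shift_mean F t) phi).
Proof. by move=> uphi; elim: n => //= n; exact: unit_fun_shift_mean. Qed.

Lemma shift_mean_contract F t phi psi e x : unit_fun phi -> unit_fun psi ->
  (forall y, `|phi y - psi y| <= e) ->
  `|shift_mean F t phi x - shift_mean F t psi x| <= e.
Proof.
move=> uphi upsi dist.
rewrite -RintegralB//; [|exact: integrable_shift|exact: integrable_shift].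
have ib : F.-integrable setT (EFin \o (fun y => phi (x + t * y) - psi (x + t * y))).
  by apply: (integrableB measurableT (integrable_shift F t x uphi)
    (integrable_shift F t x upsi)).
apply: (le_trans (le_normr_Rintegral _ ib)) => //.
have -> : e = \int[F]_y e by rewrite Rintegral_cst//= probability_setT mulr1.
apply: le_Rintegral => //.
- exact: (integrable_norm ib).
- by apply: finite_measure_integrable_cst.
Qed.

Lemma shift_mean_comm F G s t phi x : unit_fun phi ->
  shift_mean F s (shift_mean G t phi) x = shift_mean G t (shift_mean F s phi) x.
Proof.
move=> uphi; have [mphi phi01] := uphi; apply: EFin_inj.
rewrite shift_mean_EFin; last exact: unit_fun_shift_mean.
rewrite shift_mean_EFin; last exact: unit_fun_shift_mean.
under eq_integral do rewrite shift_mean_EFin//.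
under [RHS]eq_integral do rewrite shift_mean_EFin//.
pose k (z : R * R) := (phi (x + s * z.1 + t * z.2))%:E.
have mk : measurable_fun [set: R * R] k.
  apply/measurable_EFinP; apply: measurableT_comp => //.
  apply: measurable_funD => //; last exact: measurable_funM.
  by apply: measurable_funD => //; exact: measurable_funM.
have k0 z : (0 <= k z)%E by rewrite lee_fin; case/andP: (phi01 (x + s * z.1 + t * z.2)).
have := @fubini_tonelli _ _ (measurableTypeR R) (measurableTypeR R) _ F G k mk k0.
rewrite /k /= => ->; apply: eq_integral => z _; apply: eq_integral => y _.
by congr (phi _)%:E; ring.
Qed.

(** Lindeberg's replacement argument.  Replacing one factor at a time costs [e]
    each time: by commutation the replaced operator acts first on [phi], where
    the hypothesis applies, and the remaining operators are contractions. *)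
Lemma shift_mean_iter_dist F G t e phi : unit_fun phi ->
  (forall x, `|shift_mean F t phi x - shift_mean G t phi x| <= e) ->
  forall n x, `|iter n (shift_mean F t) phi x -
    iter n (shift_mean G t) phi x| <= n%:R * e.
Proof.
move=> uphi dist n; elim: n phi uphi dist => [|n IH] phi uphi dist x.
  by rewrite subrr normr0 mul0r.
rewrite !iterSr; have uF := unit_fun_shift_mean F t uphi.
have uG := unit_fun_shift_mean G t uphi.
rewrite (le_trans (ler_distD (iter n (shift_mean G t) (shift_mean F t phi) x) _ _))//.
rewrite -natr1 mulrDl mul1r lerD//.
  apply: IH => // y.
  by rewrite [X in `|_ - X|]shift_mean_comm// shift_mean_contract.
elim: n {IH} x => [|m IHm] x; first exact: dist.
by rewrite /= shift_mean_contract//; exact: unit_fun_iter.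
Qed.

Let N01 : probability (measurableTypeR R) R := normal_prob (0 : R) 1.

Lemma shift_mean_gaussian_iter (t x : R) phi n :
  continuous phi -> unit_fun phi -> 0 < t ->
  iter n.+1 (shift_mean N01 t) phi x = shift_mean N01 (Num.sqrt n.+1%:R * t) phi x.
Proof.
move=> cphi uphi t0; elim: n x => [|n IH] x; first by rewrite sqrtr1 mul1r.
rewrite iterS; apply: EFin_inj; rewrite shift_mean_EFin; last exact: unit_fun_iter.
rewrite shift_mean_EFin//.
under eq_integral do rewrite IH shift_mean_EFin//.
apply: gaussian_semigroup => //.
- by move=> y; case/andP: (uphi.2 y).
- by rewrite mulr_gt0// sqrtr_gt0.
- by rewrite mulr_gt0// sqrtr_gt0.
- by rewrite !exprMn !sqr_sqrtr// -[in LHS]natr1; ring.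
Qed.
End averaging.

Section average_of_sum.
Context d (Omega : measurableType d) (R : realType) (P : probability Omega R).
Variables (X : nat -> {mfun Omega >-> R}) (v : R -> R).
Hypotheses (Xind : mutually_independent P X) (mv : measurable_fun setT v).
Hypothesis Xlaw : forall i (A : set (measurableTypeR R)), measurable A ->
  P (X i @^-1` A) = P (X 0 @^-1` A).

(** Conditioning on the first [n] observations averages out the last one. *)
Lemma expectation_sum_iter_shift_mean (F : probability (measurableTypeR R) R) n t phi x :
  (forall A, measurable A -> F A = P ((v \o X 0) @^-1` A)) ->
  unit_fun phi ->
  \int[P]_w phi (x + t * \sum_(i < n) v (X i w)) = iter n (shift_mean F t) phi x.
Proof.
move=> FE; elim: n phi => [|n IH] phi uphi.
  under eq_Rintegral do rewrite big_ord0 mulr0 addr0.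
  by rewrite Rintegral_cst//= probability_setT mulr1.
rewrite iterSr -IH; last exact: unit_fun_shift_mean.
have [mphi phi01] := uphi.
pose Sn : {mfun Omega >-> R} :=
  mfun_Sub (mem_set (@measurable_partial_sum _ _ _ X v mv n) : _ \in mfun).
pose k (z : R * R) := (phi (x + t * (z.1 + v z.2)))%:E.
have mk : measurable_fun [set: R * R] k.
  apply/measurable_EFinP; apply: measurableT_comp => //.
  apply: measurable_funD => //; apply: measurable_funM => //.
  by apply: measurable_funD => //; exact: measurableT_comp.
have ik : P.-integrable setT (fun w => k (Sn w, X n w)).
  apply: (@unit_fun_integrable _ _ _ P
    (fun w => phi (x + t * (Sn w + v (X n w))))) => //.
  apply: measurableT_comp => //.
  apply: measurable_funD => //; apply: measurable_funM => //.
  by apply: measurable_funD => //; exact: measurableT_comp.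
congr fine.
transitivity (\int[P]_w k (Sn w, X n w))%E.
  by apply: eq_integral => w _; rewrite /k big_ord_recr.
rewrite (integral_joint_law _ mk ik); last first.
  exact: (partial_sum_independent Xind mv).
have inner u : (\int[distribution P (X n)]_y k (u, y) =
    (shift_mean F t phi (x + t * u))%:E)%E.
  have mky : measurable_fun [set: R] (fun y : R => k (u, y)).
    by apply: (measurableT_comp mk); exact: pair1_measurable.
  have k0 y : (0 <= k (u, y))%E.
    by rewrite lee_fin; case/andP: (phi01 (x + t * (u + v y))).
  rewrite shift_mean_EFin//.
  transitivity (\int[distribution P (X 0)]_y k (u, y))%E.
    by apply: eq_measure_integral => A mA _; exact: Xlaw.
  rewrite ge0_integral_distribution//.
  have mV0 : measurable_fun setT (v \o X 0 : Omega -> measurableTypeR R).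
    exact: measurableT_comp.
  pose V0 : {mfun Omega >-> measurableTypeR R} :=
    @mfun_Sub _ _ Omega (measurableTypeR R) (v \o X 0) (mem_set mV0).
  transitivity (\int[distribution P V0]_y (phi (x + t * u + t * y))%:E)%E; last first.
    by apply: eq_measure_integral => A mA _; exact/esym/FE.
  rewrite ge0_integral_distribution//.
  - by apply: eq_integral => w _; rewrite /k /= mulrDr addrA.
  - by apply/measurable_EFinP; exact: measurable_shift.
  - by move=> y; rewrite lee_fin; case/andP: (phi01 (x + t * u + t * y)).
transitivity (\int[distribution P Sn]_u (shift_mean F t phi (x + t * u))%:E)%E.
  by apply: eq_integral => u _; exact: inner.
rewrite ge0_integral_distribution//.
- apply/measurable_EFinP; apply: measurable_shift.
  by have [] := unit_fun_shift_mean F t uphi.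
- by move=> y; rewrite lee_fin; case/andP: ((unit_fun_shift_mean F t uphi).2 (x + t * y)).
Qed.
End average_of_sum.

Section one_step.
Variable R : realType.
Variable F : probability (measurableTypeR R) R.
Hypothesis mean0 : (\int[F]_y y%:E = 0)%E.
Hypothesis var1 : (\int[F]_y (y ^+ 2)%:E = 1)%E.

Let msq : measurable_fun [set: R] (fun y : R => (y ^+ 2)%:E).
Proof. by apply/measurable_EFinP; exact: measurable_funX. Qed.

Let isq : F.-integrable setT (fun y : R => (y ^+ 2)%:E).
Proof.
apply/integrableP; split => //.
under eq_integral do rewrite gee0_abs ?lee_fin ?sqr_ge0//.
by rewrite var1 ltry.
Qed.

Let icst (c : R) : F.-integrable setT (fun _ : R => c%:E).
Proof. exact: finite_measure_integrable_cst. Qed.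

Let iid : F.-integrable setT (fun y : R => y%:E).
Proof.
apply: (@le_integrable _ _ _ F setT _ _ (fun y : R => (1 + y ^+ 2)%:E)) => //.
- by apply/measurable_EFinP; exact: measurable_id.
- move=> y _ /=; rewrite lee_fin [leRHS]ger0_norm ?addr_ge0 ?sqr_ge0//.
  rewrite ler_norml; have := sqr_ge0 (y - 2^-1); have := sqr_ge0 (y + 2^-1).
  rewrite !expr2 => h1 h2; apply/andP; split; lra.
- by under eq_fun do rewrite EFinD; exact: integrableD.
Qed.

(** The bound of [taylor2_le] at the increment [t y], divided by [t ^ 2]. *)
Definition capped_sqr (t y : R) : R := Num.min (y ^+ 2) (`|t| * `|y| ^+ 3).

Definition lindeberg_rate (t : R) : R := \int[F]_y capped_sqr t y.

Let mmin t : measurable_fun [set: R] (capped_sqr t).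
Proof.
apply: measurable_minr; first exact: measurable_funX.
apply: measurable_funM => //; apply: measurable_funX.
exact: normr_measurable.
Qed.

Let min_ge0 t (y : R) : 0 <= capped_sqr t y.
Proof. by rewrite /capped_sqr le_min sqr_ge0 mulr_ge0. Qed.

Let imin t : F.-integrable setT (fun y : R => (capped_sqr t y)%:E).
Proof.
apply: (le_integrable _ _ _ isq) => //; first by apply/measurable_EFinP; exact: mmin.
move=> y _; rewrite /= lee_fin (ger0_norm (min_ge0 _ _)) (ger0_norm (sqr_ge0 _)).
by rewrite /capped_sqr ge_min lexx.
Qed.

(** Lindeberg's condition for identically distributed summands: dominated
    convergence, with [y ^ 2] as dominating function. *)
Lemma lindeberg_rate_cvg0 (t : nat -> R) : t n @[n --> \oo] --> 0 ->
  lindeberg_rate (t n) @[n --> \oo] --> 0.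
Proof.
move=> t0.
have : (\int[F]_y (capped_sqr (t n) y)%:E @[n --> \oo] -->
    \int[F]_(y in [set: R]) (cst 0%:E y))%E.
  have [] := @dominated_convergence _ (measurableTypeR R) R F setT measurableT
    (fun n (y : R) => (capped_sqr (t n) y)%:E) (cst 0%:E)
    (fun y : R => (y ^+ 2)%:E).
  - by move=> n; apply/measurable_EFinP; exact: mmin.
  - by [].
  - apply: aeW => y _; apply/cvg_EFin; first by apply: nearW.
    apply: (@squeeze_cvgr _ _ _ _ (cst 0) (fun n => `|t n| * `|y| ^+ 3)).
    + by apply: nearW => n; rewrite min_ge0 /capped_sqr ge_min lexx orbT.
    + exact: cvg_cst.
    + rewrite -(mul0r (`|y| ^+ 3)); apply: cvgM; last exact: cvg_cst.
      by rewrite -(@normr0 _ R); exact: cvg_norm.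
  - exact: isq.
  - apply: aeW => y n _; rewrite gee0_abs ?lee_fin ?min_ge0//.
    by rewrite /capped_sqr ge_min lexx.
  - by [].
rewrite integral_cst//= mul0e => h.
exact: (fine_cvg h).
Qed.

(** The expansion of the average depends on [F] only through the remainder, since
    the first two moments of [F] are 0 and 1. *)
Lemma shift_mean_logistic_taylor (p1 p2 : R -> R) :
  (forall x y, `|logistic (x + y) - logistic x - y * p1 x - y ^+ 2 * (p2 x / 2)|
    <= 2 * Num.min (y ^+ 2) (`|y| ^+ 3)) ->
  forall t z, `|shift_mean F t (@logistic R) z - logistic z - t ^+ 2 * (p2 z / 2)|
    <= 2 * t ^+ 2 * lindeberg_rate t.
Proof.
move=> taylor t z.
have uL : unit_fun (@logistic R).
  split; first by apply: continuous_measurable_fun; exact: continuous_logistic.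
  by move=> x; rewrite logistic_ge0 logistic_le1.
have iL := integrable_shift F t z uL.
have i1 : F.-integrable setT (EFin \o (fun y : R => logistic (z + t * y) - logistic z)).
  exact: integrableB iL (icst _).
have i2' : F.-integrable setT (EFin \o (fun y : R => (t * p1 z) * y)).
  exact: (integrableZl measurableT (t * p1 z) iid).
have i2 : F.-integrable setT
    (EFin \o (fun y : R => logistic (z + t * y) - logistic z - (t * p1 z) * y)).
  exact: integrableB i1 i2'.
have i3' : F.-integrable setT (EFin \o (fun y : R => (t ^+ 2 * (p2 z / 2)) * y ^+ 2)).
  exact: (integrableZl measurableT (t ^+ 2 * (p2 z / 2)) isq).
have i3 : F.-integrable setT (EFin \o (fun y : R => logistic (z + t * y) - logistic z
    - (t * p1 z) * y - (t ^+ 2 * (p2 z / 2)) * y ^+ 2)).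
  exact: integrableB i2 i3'.
have -> : shift_mean F t (@logistic R) z - logistic z - t ^+ 2 * (p2 z / 2) =
    \int[F]_y (logistic (z + t * y) - logistic z
    - (t * p1 z) * y - (t ^+ 2 * (p2 z / 2)) * y ^+ 2).
  rewrite RintegralB// RintegralB// RintegralB//; last exact: icst.
  rewrite RintegralZl// RintegralZl// Rintegral_cst//=.
  have -> : Rintegral F setT (fun y : R => y) = 0 by rewrite /Rintegral mean0.
  have -> : Rintegral F setT (fun y : R => y ^+ 2) = 1 by rewrite /Rintegral var1.
  by rewrite probability_setT /= !mulr1 mulr0 subr0.
apply: (le_trans (le_normr_Rintegral _ i3)) => //.
rewrite /lindeberg_rate -RintegralZl//; last exact: imin.
apply: le_Rintegral => //; first exact: integrable_norm i3.
  exact: (integrableZl measurableT (2 * t ^+ 2) (imin t)).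
move=> y _; have := taylor z (t * y).
rewrite exprMn (_ : t * y * p1 z = t * p1 z * y); last by ring.
rewrite (_ : t ^+ 2 * y ^+ 2 * (p2 z / 2) = t ^+ 2 * (p2 z / 2) * y ^+ 2); last by ring.
move=> /le_trans; apply.
rewrite -mulrA; apply: ler_wpM2l => //.
rewrite /capped_sqr minr_pMr ?sqr_ge0// normrM exprMn.
have -> : `|t| ^+ 3 * `|y| ^+ 3 = t ^+ 2 * (`|t| * `|y| ^+ 3).
  by rewrite -[t ^+ 2]real_normK ?num_real//; ring.
by [].
Qed.
End one_step.

Section clt.
Context d (Omega : measurableType d) (R : realType) (P : probability Omega R).
Variables (X : nat -> {mfun Omega >-> R}) (v : R -> R).
Hypotheses (Xind : mutually_independent P X) (mv : measurable_fun setT v).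
Hypothesis Xlaw : forall i (A : set (measurableTypeR R)), measurable A ->
  P (X i @^-1` A) = P (X 0 @^-1` A).
Hypothesis mean0 : (\int[P]_w (v (X 0 w))%:E = 0)%E.
Hypothesis var1 : (\int[P]_w (v (X 0 w) ^+ 2)%:E = 1)%E.
Let N01 : probability (measurableTypeR R) R := normal_prob (0 : R) 1.

(** Central limit theorem tested against all logistic functions. *)
Lemma clt_logistic (a b : R) :
  \int[P]_w logistic (a * ((Num.sqrt n%:R)^-1 * \sum_(i < n) v (X i w)) + b)
    @[n --> \oo] --> \int[N01]_y logistic (a * y + b).
Proof.
have mV0 : measurable_fun setT (v \o X 0 : Omega -> measurableTypeR R).
  exact: measurableT_comp.
pose V0 : {mfun Omega >-> measurableTypeR R} :=
  @mfun_Sub _ _ Omega (measurableTypeR R) (v \o X 0) (mem_set mV0).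
pose F : probability (measurableTypeR R) R := distribution P V0.
have msq : measurable_fun [set: R] (fun y : R => (y ^+ 2)%:E).
  by apply/measurable_EFinP; exact: measurable_funX.
have Fvar : (\int[F]_y (y ^+ 2)%:E = 1)%E.
  have q0 (y : R) : (0 <= (y ^+ 2)%:E)%E by rewrite lee_fin sqr_ge0.
  rewrite -[RHS]var1.
  exact: (@ge0_integral_distribution _ _ _ (measurableTypeR R) _ P V0 _ msq q0).
have Fmean : (\int[F]_y y%:E = 0)%E.
  have mid : measurable_fun [set: R] (fun y : R => y%:E).
    by apply/measurable_EFinP; exact: measurable_id.
  rewrite -[RHS]mean0 integralE [RHS]integralE.
  congr (_ - _)%E.
    transitivity (\int[P]_w ((fun y : R => y%:E)^\+ (V0 w)))%E.
      exact: (@ge0_integral_distribution _ _ _ (measurableTypeR R) _ P V0 _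
        (measurable_funepos mid) (funepos_ge0 _)).
    by apply: eq_integral => w _; rewrite /= !funeposE.
  transitivity (\int[P]_w ((fun y : R => y%:E)^\- (V0 w)))%E.
      exact: (@ge0_integral_distribution _ _ _ (measurableTypeR R) _ P V0 _
        (measurable_funeneg mid) (funeneg_ge0 _)).
    by apply: eq_integral => w _; rewrite /= !funenegE.
pose phi (u : R) := logistic (a * u + b).
have cphi : continuous phi.
  move=> u; apply: (cvg_comp (fun u => a * u + b) (@logistic R)).
    by apply: cvgD; [apply: cvgM; [exact: cvg_cst|exact: cvg_id]|exact: cvg_cst].
  exact: continuous_logistic.
have uphi : unit_fun phi.
  split; first exact: continuous_measurable_fun.
  by move=> u; rewrite logistic_ge0 logistic_le1.
pose t (n : nat) : R := (Num.sqrt n%:R)^-1.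
have t0 : a * t n @[n --> \oo] --> 0.
  rewrite -(mulr0 a); apply: cvgM; first exact: cvg_cst.
  apply/gtr0_cvgV0.
    by near=> n; rewrite sqrtr_gt0 ltr0n; near: n; exact: nbhs_infty_gt.
  apply/cvgryPge => A; near=> n.
  rewrite (le_trans (ler_norm A))// -sqrtr_sqr ler_wsqrtr//.
  by near: n; exact: nbhs_infty_ger.
have [p1 [p2 taylor]] := logistic_taylor R.
have step G (s x : R) : shift_mean G s phi x =
    shift_mean G (a * s) (@logistic R) (a * x + b).
  by apply: eq_Rintegral => y _; rewrite /phi; congr logistic; ring.
(* n replacements, each costing 2 (a / sqrt n)^2 times the remainders *)
pose r n := 2 * a ^+ 2 * (lindeberg_rate F (a * t n) + lindeberg_rate N01 (a * t n)).
have r0 : r n @[n --> \oo] --> 0.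
  rewrite -(mulr0 (2 * a ^+ 2)); apply: cvgM; first exact: cvg_cst.
  rewrite -(addr0 0); apply: cvgD; first exact: lindeberg_rate_cvg0 t0.
  by apply: lindeberg_rate_cvg0 t0; exact: gaussian_second_moment.
have key n : `|\int[P]_w phi (t n.+1 * \sum_(i < n.+1) v (X i w))
    - \int[N01]_y phi y| <= r n.+1.
  have sn0 : Num.sqrt n.+1%:R != 0 :> R by rewrite gt_eqF// sqrtr_gt0 ltr0n.
  have tn0 : 0 < t n.+1 by rewrite invr_gt0 sqrtr_gt0 ltr0n.
  have -> : \int[P]_w phi (t n.+1 * \sum_(i < n.+1) v (X i w)) =
      iter n.+1 (shift_mean F (t n.+1)) phi 0.
    rewrite -(expectation_sum_iter_shift_mean Xind mv Xlaw)//.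
    by apply: eq_Rintegral => w _; rewrite add0r.
  have -> : \int[N01]_y phi y = iter n.+1 (shift_mean N01 (t n.+1)) phi 0.
    (* sqrt(n + 1) * t (n + 1) = 1 *)
    rewrite shift_mean_gaussian_iter// divff//.
    by apply: eq_Rintegral => y _; rewrite add0r mul1r.
  have e1 x : `|shift_mean F (t n.+1) phi x - shift_mean N01 (t n.+1) phi x| <=
      2 * (a * t n.+1) ^+ 2 *
        (lindeberg_rate F (a * t n.+1) + lindeberg_rate N01 (a * t n.+1)).
    have := shift_mean_logistic_taylor Fmean Fvar taylor (a * t n.+1) (a * x + b).
    have := shift_mean_logistic_taylor (@gaussian_mean R) (@gaussian_second_moment R)
      taylor (a * t n.+1) (a * x + b).
    rewrite !step mulrDr => /(lerD _) h /h; rewrite addrC => {}h; apply: le_trans h.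
    rewrite distrC -[X in _ <= _ + X]normrN; apply: le_trans (ler_normD _ _).
    by rewrite le_eqVlt; apply/orP; left; apply/eqP; congr Num.norm; rewrite /N01; ring.
  apply: (le_trans (shift_mean_iter_dist uphi e1 _ _)).
  rewrite /r le_eqVlt; apply/orP; left; apply/eqP.
  rewrite mulrA; congr (_ * _); rewrite exprMn /t exprVn sqr_sqrtr//.
  by field; rewrite addrC natr1 pnatr_eq0.
rewrite -(cvg_shiftS); apply/cvgrPdist_le => e e0.
move: r0; rewrite -(cvg_shiftS) => /cvgrPdist_le /(_ e e0) r0.
near=> n; rewrite distrC; apply: (le_trans (key n)).
have := near r0 n; rewrite sub0r normrN => /(_ _) h.
by rewrite (le_trans (ler_norm _))// h//; near: n.
Unshelve. all: by end_near. Qed.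
End clt.

(** * From logistic test functions to the chi-squared limit *)

Section sandwich.
Variable R : realType.

Lemma logistic_homo (x y : R) : x <= y -> logistic y <= logistic x.
Proof.
move=> xy; rewrite /logistic lef_pV2 ?posrE ?ltr_pwDl ?expR_ge0//.
by rewrite lerD2l ler_expR.
Qed.

Lemma logistic_far (e z : R) : 0 < e -> e^-1 <= z -> logistic z <= e.
Proof.
move=> e0 ez; rewrite /logistic invf_ple ?posrE ?ltr_pwDl ?expR_ge0//.
by apply: (le_trans ez); have := expR_ge1Dx z; lra.
Qed.

Lemma logisticN (z : R) : logistic (- z) = 1 - logistic z.
Proof.
rewrite /logistic expRN; have := expR_gt0 z; move: (expR z) => E E0.
by field; rewrite !gt_eqF// ltr_pwDl// ltW.
Qed.

Definition bump (a m w : R) : R := logistic (a * w - a * m) - logistic (a * w + a * m).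

(** With [m] half-way between [b] and [c], a difference of two logistic functions
    centred at [m] and [- m] approximates the indicator of the interval between
    them; the steepness [a] makes each one [e]-close to its limit values at
    distance [(c - b) / 2] from its centre. *)
Lemma bump_sandwich (b c e : R) : 0 <= b -> b < c -> 0 < e ->
  exists a m : R, [/\ forall w, 0 <= bump a m w <= 1,
    forall w, `|w| <= b -> 1 - e *+ 2 <= bump a m w
    & forall w, c <= `|w| -> bump a m w <= e].
Proof.
move=> b0 bc e0; pose m := (b + c) / 2; pose a := e^-1 / ((c - b) / 2).
have h0 : 0 < (c - b) / 2 by rewrite divr_gt0// subr_gt0.
have a0 : 0 < a by rewrite divr_gt0// invr_gt0.
have m0 : 0 <= m by rewrite divr_ge0// addr_ge0// ltW// (le_lt_trans b0).
have far z : (c - b) / 2 <= z -> e^-1 <= a * z.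
  by move=> hz; rewrite /a mulrAC ler_pdivlMr// ler_pM2l// invr_gt0.
have small z : (c - b) / 2 <= z -> logistic (a * z) <= e.
  by move=> /far; exact: logistic_far.
have large z : z <= - ((c - b) / 2) -> 1 - e <= logistic (a * z).
  move=> hz; rewrite -[a * z]opprK -mulrN logisticN lerD2l lerN2.
  by apply: small; lra.
exists a, m; split => w; rewrite /bump -mulrBr -mulrDr.
- have := logistic_ge0 (a * (w + m)); have := logistic_le1 (a * (w - m)).
  have : logistic (a * (w + m)) <= logistic (a * (w - m)).
    by apply: logistic_homo; rewrite ler_pM2l//; lra.
  by move=> h1 h2 h3; apply/andP; split; lra.
- rewrite ler_norml => /andP[w1 w2].
  have := @small (w + m); have := @large (w - m); rewrite /m => h1 h2.
  have {}h1 := h1 ltac:(lra); have {}h2 := h2 ltac:(lra).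
  by rewrite mulr2n; lra.
- have := logistic_ge0 (a * (w + m)); have := logistic_le1 (a * (w - m)).
  rewrite ler_normr => l1 l0 /orP[w1|w1].
    have := @small (w - m); rewrite /m => h1; have {}h1 := h1 ltac:(lra).
    by rewrite /m in l0 l1 h1 *; lra.
  have := @large (w + m); rewrite /m => h1; have {}h1 := h1 ltac:(lra).
  by rewrite /m in l0 l1 h1 *; lra.
Qed.

Section bump_expectation.
Context d (T : measurableType d) (P : probability T R) (W : T -> R).
Hypothesis mW : measurable_fun setT W.
Variables (a m : R).
Hypothesis bump01 : forall w, 0 <= bump a m w <= 1.

Let Ebump := \int[P]_w logistic (a * W w + - (a * m)) -
  \int[P]_w logistic (a * W w + a * m).

Let ilog b : P.-integrable setT (EFin \o (fun w => logistic (a * W w + b))).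
Proof.
apply: unit_fun_integrable => [|w]; last by rewrite logistic_ge0 logistic_le1.
apply: measurableT_comp.
  by apply: continuous_measurable_fun; exact: continuous_logistic.
by apply: measurable_funD => //; exact: measurable_funM.
Qed.

Let EbumpE : Ebump = \int[P]_w bump a m (W w).
Proof. by rewrite /Ebump -RintegralB//; exact: ilog. Qed.

Let ibump : P.-integrable setT (EFin \o (fun w => bump a m (W w))).
Proof. exact: integrableB (ilog (- (a * m))) (ilog (a * m)). Qed.

Let iindic (A : set T) (e : R) : measurable A ->
  P.-integrable setT (EFin \o (fun w => \1_A w + e)).
Proof.
move=> mA; rewrite (_ : _ \o _ = (fun w => (\1_A w)%:E + e%:E)%E)//.
apply: integrableD => //; first exact: integrable_indic.
exact: finite_measure_integrable_cst.
Qed.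

Let Eindic (A : set T) (e : R) : measurable A ->
  \int[P]_w (\1_A w + e) = fine (P A) + e.
Proof.
move=> mA; rewrite RintegralD//.
- by rewrite Rintegral_cst//= probability_setT mulr1 /Rintegral integral_indic// setIT.
- exact: integrable_indic.
- exact: finite_measure_integrable_cst.
Qed.

Lemma prob_le_bump (A : set T) (e : R) : measurable A -> 0 <= e ->
  (forall w, A w -> 1 - e <= bump a m (W w)) -> fine (P A) <= Ebump + e.
Proof.
move=> mA e0 Ab; rewrite EbumpE -lerBlDr -Eindic//.
apply: le_Rintegral => //; [exact: iindic|move=> w _].
rewrite indicE; case: (boolP (w \in A)) => wA /=; first by apply: Ab; exact/set_mem.
by rewrite add0r (le_trans (_ : - e <= 0)) ?oppr_le0//; case/andP: (bump01 (W w)).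
Qed.

Lemma bump_le_prob (A : set T) (e : R) : measurable A -> 0 <= e ->
  (forall w, ~ A w -> bump a m (W w) <= e) -> Ebump <= fine (P A) + e.
Proof.
move=> mA e0 Ab; rewrite EbumpE -Eindic//.
apply: le_Rintegral => //; [exact: iindic|move=> w _].
rewrite indicE; case: (boolP (w \in A)) => wA /=.
  by case/andP: (bump01 (W w)) => _ /le_trans; apply; rewrite lerDl.
by rewrite add0r; apply: Ab => /mem_set; rewrite (negbTE wA).
Qed.
End bump_expectation.
End sandwich.

Section chi_square_limit.
Context d (Omega : measurableType d) (R : realType) (P : probability Omega R).
Let N01 : probability (measurableTypeR R) R := normal_prob (0 : R) 1.
Variable W : nat -> Omega -> R.
Hypothesis mW : forall n, measurable_fun setT (W n).
Hypothesis W_logistic : forall a b : R,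
  \int[P]_w logistic (a * W n w + b) @[n --> \oo] --> \int[N01]_y logistic (a * y + b).

Let msq d' (T : measurableType d') (V : T -> R) (x : R) : measurable_fun setT V ->
  measurable [set w | V w ^+ 2 <= x].
Proof.
move=> mV; rewrite -[X in measurable X]setTI.
by apply: (measurable_fun_le measurableT) => //; exact: measurable_funX.
Qed.

Let N_le (x : R) : R := fine (N01 [set y : R | y ^+ 2 <= x]).
Let P_le n (x : R) : R := fine (P [set w | W n w ^+ 2 <= x]).

(** Weak convergence of the squares, stated with different arguments on the two
    sides so that jumps of the limit distribution function do no harm. *)
Lemma square_cdf_squeeze (x x' e : R) : x < x' -> 0 < e ->
  \forall n \near \oo, P_le n x <= N_le x' + e /\ N_le x <= P_le n x' + e.
Proof.
move=> xx' e0; have [x0|x0] := ltP x 0.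
  have sq0 T (V : T -> R) : [set w | V w ^+ 2 <= x] = set0.
    apply/seteqP; split => w //=; rewrite leNgt => /negP; apply.
    by rewrite (lt_le_trans x0)// sqr_ge0.
  near=> n; rewrite /P_le /N_le !sq0 !measure0 /=.
  by split; rewrite addr_ge0// ?fine_ge0// ltW.
have e6 : 0 < e / 6 by rewrite divr_gt0.
have sx : Num.sqrt x < Num.sqrt x' by rewrite ltr_sqrt// (le_lt_trans x0).
have [a [m [b01 lo hi]]] := bump_sandwich (sqrtr_ge0 x) sx e6.
have lo' T (V : T -> R) w : [set w | V w ^+ 2 <= x] w ->
    1 - (e / 6) *+ 2 <= bump a m (V w).
  by move=> /= h; apply: lo; rewrite -sqrtr_sqr ler_wsqrtr.
have hi' T (V : T -> R) w : ~ [set w | V w ^+ 2 <= x'] w ->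
    bump a m (V w) <= e / 6.
  move=> /= /negP; rewrite -ltNge => h; apply: hi.
  by rewrite -sqrtr_sqr ler_wsqrtr// ltW.
have c1 := @W_logistic a (- (a * m)); have c2 := @W_logistic a (a * m).
have : (\int[P]_w logistic (a * W n w - a * m) -
    \int[P]_w logistic (a * W n w + a * m)) @[n --> \oo] -->
    \int[N01]_y logistic (a * y - a * m) - \int[N01]_y logistic (a * y + a * m).
  exact: cvgB c1 c2.
move=> /cvgrPdist_le /(_ _ e6) c.
have mid : measurable_fun [set: R] (id : R -> R) by exact: measurable_id.
have e60 : 0 <= (e / 6) *+ 2 by rewrite mulrn_wge0// ltW.
have := @prob_le_bump R _ _ N01 id mid a m b01 _ _ (msq x mid) e60 (lo' _ _).
have := @bump_le_prob R _ _ N01 id mid a m b01 _ _ (msq x' mid) (ltW e6) (hi' _ _).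
rewrite -/(N_le x) -/(N_le x') /= => N1 N2.
near=> n.
have : `|\int[N01]_y logistic (a * y - a * m) - \int[N01]_y logistic (a * y + a * m)
  - (\int[P]_w logistic (a * W n w - a * m) - \int[P]_w logistic (a * W n w + a * m))|
   <= e / 6.
  by near: n.
rewrite ler_norml => /andP[h1 h2].
have := @prob_le_bump R _ _ P _ (mW n) a m b01 _ _ (msq x (mW n)) e60 (lo' _ _).
have := @bump_le_prob R _ _ P _ (mW n) a m b01 _ _ (msq x' (mW n)) (ltW e6) (hi' _ _).
rewrite -/(P_le n x) -/(P_le n x') => P1 P2.
rewrite mulr2n in P2 N2.
by split; lra.
Unshelve. all: by end_near. Qed.

Variables (V : nat -> Omega -> R) (B : nat -> set Omega).
Hypothesis mV : forall n, measurable_fun setT (V n).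
Hypothesis mB : forall n, measurable (B n).
Hypothesis VW : forall n w, ~ B n w -> V n w = W n w ^+ 2.
Hypothesis PB : forall e : R, 0 < e -> \forall n \near \oo, fine (P (B n)) <= e.

(** Slutsky's argument in the form needed: [V n] may differ from [W n ^ 2] on an
    event of vanishing probability. *)
Lemma cvg_in_distribution_chi_square1 : cvg_in_distribution P V (@chi_square1 R).
Proof.
rewrite /cvg_in_distribution => x cx.
pose D y := chi_square1 [set t : R | t <= y].
have DE y : D y = (N_le y)%:E.
  by rewrite /N_le fineK//; apply: fin_num_measure; exact: msq.
have cN : N_le y @[y --> x] --> N_le x.
  rewrite (_ : N_le = fine \o D); last by apply/funext => y; rewrite /= DE.
  by apply: fine_cvg; rewrite /= DE /= -DE; exact: cx.
have mVx n : measurable [set w | V n w <= x].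
  rewrite -[X in measurable X]setTI.
  by apply: (measurable_fun_le measurableT).
have lawE n : law P (V n) [set t | t <= x] = (fine (P [set w | V n w <= x]))%:E.
  by rewrite fineK//; exact: fin_num_measure.
under eq_fun do rewrite lawE.
rewrite -/(D x) DE; apply: cvg_EFin; first by apply: nearW.
have Pfin A : measurable A -> P A = (fine (P A))%:E.
  by move=> mA; rewrite fineK//; exact: fin_num_measure.
have VWup n : fine (P [set w | V n w <= x]) <= P_le n x + fine (P (B n)).
  have mWx := msq x (mW n).
  rewrite -lee_fin EFinD -!Pfin//.
  apply: le_trans (measureU2 _ mWx (mB n)); apply: le_measure; rewrite ?inE//.
    exact: measurableU.
  move=> w /=; have [Bw|Bw] := pselect (B n w); first by right.
  by rewrite VW//; left.
have VWlo n : P_le n x <= fine (P [set w | V n w <= x]) + fine (P (B n)).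
  have mWx := msq x (mW n).
  rewrite -lee_fin EFinD -!Pfin//.
  apply: le_trans (measureU2 _ (mVx n) (mB n)); apply: le_measure; rewrite ?inE//.
    exact: measurableU.
  move=> w /=; have [Bw|Bw] := pselect (B n w); first by right.
  by rewrite -VW//; left.
apply/cvgrPdist_le => e e0; have e3 : 0 < e / 3 by rewrite divr_gt0.
move/cvgrPdist_le : cN => /(_ _ e3) [/= r r0 rN].
have r2 : 0 < r / 2 by rewrite divr_gt0.
have Nup : N_le (x + r / 2) <= N_le x + e / 3.
  have := rN (x + r / 2); rewrite /= opprD addrA subrr sub0r normrN gtr0_norm// => h.
  have := h ltac:(lra); rewrite ler_norml => /andP[]; lra.
have Nlo : N_le x <= N_le (x - r / 2) + e / 3.
  have := rN (x - r / 2); rewrite /= opprB addrCA subrr addr0 gtr0_norm// => h.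
  have := h ltac:(lra); rewrite ler_norml => /andP[]; lra.
have xup : x < x + r / 2 by rewrite ltrDl.
have xlo : x - r / 2 < x by rewrite gtrDl oppr_lt0.
near=> n.
have [s1 _] : P_le n x <= N_le (x + r / 2) + e / 3 /\
    N_le x <= P_le n (x + r / 2) + e / 3.
  by near: n; exact: square_cdf_squeeze.
have [_ s2] : P_le n (x - r / 2) <= N_le x + e / 3 /\
    N_le (x - r / 2) <= P_le n x + e / 3.
  by near: n; exact: square_cdf_squeeze.
have s3 : fine (P (B n)) <= e / 3 by near: n; exact: PB.
have := VWup n; have := VWlo n.
move: s1 s2 s3 Nup Nlo; rewrite ler_norml => s1 s2 s3 Nup Nlo v1 v2.
by apply/andP; split; lra.
Unshelve. all: by end_near. Qed.
End chi_square_limit.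

(** * The score statistics and the selected dimension *)

(** The value of [f] at the selected index is a finite nesting of conditionals,
    one for each candidate index. *)
Lemma measurable_first_argmax d (T : measurableType d) (R : realType) (K : nat)
    (c f : nat -> T -> R) :
  (forall k, measurable_fun setT (c k)) -> (forall k, measurable_fun setT (f k)) ->
  measurable_fun setT (fun w => f (first_argmax K (c ^~ w)) w).
Proof.
move=> mc mf; rewrite /first_argmax.
have mall k s : measurable_fun setT (fun w => all (fun l => c l w <= c k w) s).
  elim: s => [|l s IH] //=; apply: measurable_and => //.
  exact: measurable_fun_ler.
suff gen s0 s : measurable_fun setT
    (fun w => f (head 0%N [seq k <- s | all (fun l => c l w <= c k w) s0]) w).
  exact: gen.
elim: s => [|k s IH] //=.
rewrite (_ : (fun w => _) = (fun w => if all (fun l => c l w <= c k w) s0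
    then f k w else f (head 0%N [seq k0 <- s | all (fun l => c l w <= c k0 w) s0]) w)).
  exact: (measurable_fun_ifT (mall k s0) (mf k) IH).
by apply/funext => w; case: ifP.
Qed.

Section rintegral_extra.
Context d (T : measurableType d) (R : realType).

Lemma Rintegral_sum (P : {measure set T -> \bar R}) (I : finType) (f : I -> T -> R) :
  (forall i, P.-integrable setT (EFin \o f i)) ->
  \int[P]_w (\sum_i f i w) = \sum_i \int[P]_w f i w.
Proof.
move=> fi; apply: EFin_inj; rewrite -sumEFin /Rintegral fineK; last first.
  apply: integrable_fin_num => //.
  have := @integrable_sum _ _ _ P setT measurableT I (index_enum I) xpredT
    (fun i => EFin \o f i) (fun i _ => fi i).
  by apply: eq_integrable => // w _; rewrite /= -sumEFin.
transitivity (\int[P]_w (\sum_i (EFin \o f i) w))%E.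
  by apply: eq_integral => w _; rewrite -sumEFin.
rewrite integral_sum//; apply: eq_bigr => i _.
by rewrite fineK//; apply: integrable_fin_num => //; exact: fi.
Qed.

Lemma integrable_Rsum (P : {measure set T -> \bar R}) (I : finType) (f : I -> T -> R) :
  (forall i, P.-integrable setT (EFin \o f i)) ->
  P.-integrable setT (EFin \o (fun w => \sum_i f i w)).
Proof.
move=> fi.
have := @integrable_sum _ _ _ P setT measurableT I (index_enum I) xpredT
    (fun i => EFin \o f i) (fun i _ => fi i).
by apply: eq_integrable => // w _; rewrite /= -sumEFin.
Qed.

Lemma integrable_Rscale (P : {measure set T -> \bar R}) (c : R) (f : T -> R) :
  P.-integrable setT (EFin \o f) -> P.-integrable setT (EFin \o (fun w => c * f w)).
Proof. by move=> fi; exact: (integrableZl measurableT c fi). Qed.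

Lemma integrable_mul_sqr (P : {measure set T -> \bar R}) (f g : T -> R) :
  measurable_fun setT f -> measurable_fun setT g ->
  P.-integrable setT (fun w => (f w ^+ 2)%:E) ->
  P.-integrable setT (fun w => (g w ^+ 2)%:E) ->
  P.-integrable setT (EFin \o (fun w => f w * g w)).
Proof.
move=> mf mg fi gi.
apply: (le_integrable measurableT _ _ (integrableD measurableT fi gi)).
  by apply/measurable_EFinP; exact: measurable_funM.
move=> w _ /=; rewrite lee_fin [leRHS]ger0_norm ?addr_ge0 ?sqr_ge0//.
rewrite ler_norml; have := sqr_ge0 (f w - g w); have := sqr_ge0 (f w + g w).
have := sqr_ge0 (f w); have := sqr_ge0 (g w).
rewrite !expr2 => h1 h2 h3 h4; apply/andP; split; lra.
Qed.

Lemma integrable_of_sqr (P : probability T R) (f : T -> R) :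
  measurable_fun setT f -> P.-integrable setT (fun w => (f w ^+ 2)%:E) ->
  P.-integrable setT (EFin \o f).
Proof.
move=> mf fi; have c1 : P.-integrable setT (fun w => ((cst (1 : R) w) ^+ 2)%:E).
  by rewrite /= expr1n; exact: finite_measure_integrable_cst.
have := integrable_mul_sqr mf (measurable_cst (1 : R)) fi c1.
by apply: eq_integrable => // w _; rewrite /= mulr1.
Qed.

Lemma markov_Rintegral (P : probability T R) (f : T -> R) (t : R) :
  measurable_fun setT f -> (forall w, 0 <= f w) ->
  P.-integrable setT (EFin \o f) -> 0 < t ->
  fine (P [set w | t <= f w]) <= (\int[P]_w f w) / t.
Proof.
move=> mf f0 fi t0; set A := [set w | _].
have mA : measurable A.
  rewrite -[A]setTI; exact: (measurable_fun_le measurableT).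
rewrite ler_pdivlMr// mulrC.
have -> : t * fine (P A) = \int[P]_w (t * \1_A w).
  rewrite RintegralZl//; last exact: integrable_indic.
  by rewrite /Rintegral integral_indic// setIT.
apply: le_Rintegral => //.
  by apply: integrable_Rscale; exact: integrable_indic.
move=> w _; rewrite indicE; case: (boolP (w \in A)) => wA /=.
  by rewrite mulr1; exact: (set_mem wA).
by rewrite mulr0.
Qed.
End rintegral_extra.

(** The first candidate is selected as soon as it is maximal. *)
Lemma first_argmax_neq1 (R : realType) (K : nat) (c : nat -> R) : (0 < K)%N ->
  first_argmax K c != 1%N -> exists2 k, (1 < k <= K)%N & c 1%N < c k.
Proof.
case: K => // K _; rewrite /first_argmax => h; apply: contrapT => H.
move: h; rewrite /= lexx /=.
suff -> : all (fun l => c l <= c 1%N) (iota 2 K) by [].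
apply/allP => k; rewrite mem_iota => /andP[k1 k2].
rewrite leNgt; apply/negP => ck; apply: H; exists k => //.
by rewrite k1 -ltnS -(add2n K).
Qed.

Section scores.
Context d (Omega : measurableType d) (R : realType) (P : probability Omega R).
Variables (X : nat -> {mfun Omega >-> R}) (psi : nat -> R -> R) (al : nat -> R).
Hypothesis Xind : mutually_independent P X.
Hypothesis Xlaw : forall i (A : set (measurableTypeR R)), measurable A ->
  P (X i @^-1` A) = P (X 0 @^-1` A).
Hypothesis mpsi : forall j, (0 < j)%N -> measurable_fun setT (psi j).
Let xi j (x : R) := psi j x - al j.
Hypothesis xi_sqr : forall j a, (0 < j)%N ->
  P.-integrable setT (fun w => (xi j (X a w) ^+ 2)%:E).
Hypothesis xi_mean : forall j a, (0 < j)%N -> \int[P]_w xi j (X a w) = 0.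
Variable S : nat -> nat -> R.
Hypothesis xi_cov : forall i j a, (0 < i)%N -> (0 < j)%N ->
  \int[P]_w (xi i (X a w) * xi j (X a w)) = S i j.
Variable Sig : forall k, 'M[R]_k.
Hypothesis SigE : forall k, Sig k = \matrix_(i, j) S i.+1 j.+1.
Hypothesis Sig_unit : forall k, (0 < k)%N -> Sig k \in unitmx.

Let mxi j : (0 < j)%N -> measurable_fun setT (xi j).
Proof. by move=> j0; apply: measurable_funB => //; exact: mpsi. Qed.

Let mxiX j a : (0 < j)%N -> measurable_fun setT (fun w => xi j (X a w)).
Proof. by move=> j0; apply: measurableT_comp => //; exact: mxi. Qed.

Let ixi i j a b : (0 < i)%N -> (0 < j)%N ->
  P.-integrable setT (EFin \o (fun w => xi i (X a w) * xi j (X b w))).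
Proof.
move=> i0 j0.
by apply: integrable_mul_sqr; [exact: mxiX|exact: mxiX|exact: xi_sqr..].
Qed.

Let xi_cross i j a b : (0 < i)%N -> (0 < j)%N -> a != b ->
  \int[P]_w (xi i (X a w) * xi j (X b w)) = 0.
Proof.
move=> i0 j0 ab.
pose k (z : R * R) : \bar R := (xi i z.1 * xi j z.2)%:E.
have mk : measurable_fun [set: R * R] k.
  apply/measurable_EFinP; apply: measurable_funM.
    by apply: measurableT_comp => //; exact: mxi.
  by apply: measurableT_comp => //; exact: mxi.
rewrite /Rintegral -[X in fine X]/(\int[P]_w k (X a w, X b w))%E.
rewrite (@integral_joint_law _ _ _ P _ _ _ _ (X a) (X b) k
  (mutually_independent_pair Xind ab) mk (ixi a b i0 j0)).
have inner x : (\int[distribution P (X b)]_y k (x, y) = 0)%E.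
  have i1 : P.-integrable setT (EFin \o (fun w => xi j (X b w))).
    by apply: integrable_of_sqr; [exact: mxiX|exact: xi_sqr].
  have i2 : P.-integrable setT ((fun y => k (x, y)) \o X b).
    exact: (integrable_Rscale (xi i x) i1).
  rewrite integral_distribution//; last first.
    by apply: (measurableT_comp mk); exact: pair1_measurable.
  transitivity ((xi i x)%:E * \int[P]_w (xi j (X b w))%:E)%E.
    by rewrite -integralZl//; apply: eq_integral => w _; rewrite /k /= EFinM.
  rewrite -[X in (_ * X)%E]fineK; last exact: integrable_fin_num.
  by have := xi_mean b j0; rewrite /Rintegral => ->; rewrite mule0.
by rewrite integral0_eq// => x _; exact: inner.
Qed.

Let bh := bhat psi al X.

Let bhE n p q w : bh n p w * bh n q w =
  \sum_(ab : 'I_n * 'I_n) (n%:R^-1 * (xi p (X ab.1 w) * xi q (X ab.2 w))).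
Proof.
rewrite /bh /bhat mulrACA -invfM -expr2 sqr_sqrtr//.
by rewrite big_distrlr pair_bigA mulr_sumr.
Qed.

Let ibh n p q : (0 < p)%N -> (0 < q)%N ->
  P.-integrable setT (EFin \o (fun w => bh n p w * bh n q w)).
Proof.
move=> p0 q0; under eq_fun do rewrite bhE.
by apply: integrable_Rsum => ab; apply: integrable_Rscale; exact: ixi.
Qed.

Let Ebh n p q : (0 < n)%N -> (0 < p)%N -> (0 < q)%N ->
  \int[P]_w (bh n p w * bh n q w) = S p q.
Proof.
move=> n0 p0 q0; under eq_Rintegral do rewrite bhE.
rewrite Rintegral_sum; last by move=> ab; apply: integrable_Rscale; exact: ixi.
transitivity (\sum_(ab : 'I_n * 'I_n) (n%:R^-1 * (S p q *+ (ab.1 == ab.2)))).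
  apply: eq_bigr => -[a b] _ /=; rewrite RintegralZl//; last exact: ixi.
  by have [->|ab] := eqVneq a b; [rewrite xi_cov|rewrite xi_cross].
rewrite -(pair_bigA _ (fun a b : 'I_n => n%:R^-1 * (S p q *+ (a == b))))/=.
under eq_bigr => a _.
  rewrite (bigD1 a)//= eqxx big1 ?addr0; last first.
    by move=> b; rewrite eq_sym => /negbTE ->; rewrite mulr0.
  over.
rewrite sumr_const card_ord -mulrnAl -[_ *+ n]mulr_natr mulVf ?mul1r//.
by rewrite pnatr_eq0 -lt0n.
Qed.

Let T := Tstat psi al Sig X.

Let TE n k w : T n k w = quad (invmx (Sig k)) (Bvec psi al X n k w).
Proof. by []. Qed.

Let Tsum n k w : T n k w = \sum_(pq : 'I_k * 'I_k)
  invmx (Sig k) pq.1 pq.2 * (bh n pq.1.+1 w * bh n pq.2.+1 w).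
Proof.
rewrite TE quadE pair_bigA; apply: eq_bigr => -[p q] _ /=.
by rewrite !mxE -mulrA mulrCA.
Qed.

Let Sig_sym k : (Sig k)^T = Sig k.
Proof.
rewrite SigE; apply/matrixP => i j; rewrite !mxE.
rewrite -!(xi_cov 0)//; apply: eq_Rintegral => w _; exact: mulrC.
Qed.

(** The form of [Sig k] at [x] is the second moment of the score combination with
    coefficients [x]. *)
Lemma score_covariance_psd k : psd (Sig k).
Proof.
split=> // x; rewrite quadE pair_bigA /=.
have -> : \sum_(p : 'I_k * 'I_k) x 0 p.1 * Sig k p.1 p.2 * x 0 p.2 =
    \int[P]_w ((\sum_p x 0 p * xi p.+1 (X 0 w)) ^+ 2).
  transitivity (\int[P]_w (\sum_(pq : 'I_k * 'I_k) (x 0 pq.1 * x 0 pq.2) *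
      (xi pq.1.+1 (X 0 w) * xi pq.2.+1 (X 0 w)))).
    rewrite Rintegral_sum; last by move=> pq; apply: integrable_Rscale; exact: ixi.
    apply: eq_bigr => -[p q] _; rewrite RintegralZl//; last exact: ixi.
    by rewrite xi_cov// SigE mxE /= mulrAC.
  apply: eq_Rintegral => w _; rewrite expr2 big_distrlr /= pair_bigA.
  by apply: eq_bigr => pq _; rewrite mulrACA.
by apply: Rintegral_ge0 => w _; exact: sqr_ge0.
Qed.

Lemma score_statistic_mono n k l w : (0 < k)%N -> (k <= l)%N -> T n k w <= T n l w.
Proof.
move=> k0 kl; rewrite -(subnKC kl); set m := (l - k)%N; rewrite !TE.
have ulE : ulsubmx (Sig (k + m)) = Sig k.
  by rewrite !SigE; apply/matrixP => i j; rewrite !mxE.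
have lsE : lsubmx (Bvec psi al X n (k + m) w) = Bvec psi al X n k w.
  by apply/rowP => j; rewrite !mxE.
rewrite -ulE -lsE; apply: quad_invmx_ulsub.
- exact: score_covariance_psd.
- by rewrite Sig_unit// addn_gt0 k0.
- by rewrite ulE Sig_unit.
Qed.

Lemma score_statistic_ge0 n k w : (0 < k)%N -> 0 <= T n k w.
Proof.
move=> k0; rewrite TE.
have := quad_invmx_ge (Bvec psi al X n k w) 0 (score_covariance_psd k) (Sig_unit k0).
by rewrite /quad !mul0mx !mxE mul0rn subrr.
Qed.

Lemma integrable_score_statistic n k : P.-integrable setT (EFin \o T n k).
Proof.
rewrite (_ : T n k = fun w => \sum_(pq : 'I_k * 'I_k)
  invmx (Sig k) pq.1 pq.2 * (bh n pq.1.+1 w * bh n pq.2.+1 w)); last exact/funext/Tsum.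
by apply: integrable_Rsum => pq; apply: integrable_Rscale; exact: ibh.
Qed.

Lemma measurable_score_statistic n k : measurable_fun setT (T n k).
Proof.
by apply/measurable_EFinP; case/integrableP: (integrable_score_statistic n k).
Qed.

(** The covariance of the score vector is [Sig k], so the expectation is the trace
    of the identity matrix. *)
Lemma expectation_score_statistic n k : (0 < n)%N -> (0 < k)%N ->
  \int[P]_w T n k w = k%:R.
Proof.
move=> n0 k0; under eq_Rintegral do rewrite Tsum.
rewrite Rintegral_sum; last by move=> pq; apply: integrable_Rscale; exact: ibh.
transitivity (\tr (invmx (Sig k) *m Sig k)); last first.
  by rewrite mulVmx ?Sig_unit// mxtrace1.
rewrite /mxtrace; under [RHS]eq_bigr do rewrite mxE.
rewrite pair_bigA; apply: eq_bigr => -[p q] _ /=.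
rewrite RintegralZl//; last exact: ibh.
by rewrite Ebh//; congr (_ * _); rewrite -(Sig_sym k) SigE !mxE.
Qed.

Section selection.
Variable kn : nat -> nat.
Hypothesis kn_gt0 : forall n, (0 < kn n)%N.

Let A n i := [set w | (2 ^ i.+2)%:R / 4 * ln n%:R <= T n (2 ^ i.+2) w].

(** Candidate dimensions beyond 1 lie in the blocks from [2 ^ i.+1] to [2 ^ i.+2],
    with [i.+1] at most the binary logarithm of [kn n]. *)
Definition dyadic_exceedance n : set Omega :=
  \big[setU/set0]_(i < trunc_log 2 (kn n)) A n i.

Lemma measurable_dyadic_exceedance n : measurable (dyadic_exceedance n).
Proof.
apply: bigsetU_measurable => i _; rewrite -[X in measurable X]setTI.
apply: (measurable_fun_le measurableT) => //; exact: measurable_score_statistic.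
Qed.

(** Monotonicity in the dimension moves an excess at [k] to the end
    [2 ^ i.+1] of the dyadic block of [k], at the price of a factor 4. *)
Lemma selection_dyadic_exceedance n w : 1 < n%:R :> R ->
  Ssel psi al Sig X kn n w <> 1%N -> dyadic_exceedance n w.
Proof.
move=> n1 /eqP; have L0 : 0 < ln (n%:R : R) by exact: ln_gt0.
move=> /(first_argmax_neq1 (kn_gt0 n))[k /andP[k1 kK]]; rewrite -/T => Tk.
have k0 : (0 < k)%N by exact: ltnW.
pose i := trunc_log 2 k.
have i1 : (0 < i)%N by rewrite trunc_log_gt0.
have iK : (i <= trunc_log 2 (kn n))%N by exact: leq_trunc_log.
have klt : (k < 2 ^ i.+1)%N by exact: trunc_log_ltn.
have kge : (2 ^ i <= k)%N by exact: trunc_logP.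
(* blocks are numbered from 0 *)
have iE : i.-1.+2 = i.+1 by rewrite prednK.
have iK' : (i.-1 < trunc_log 2 (kn n))%N by rewrite prednK.
rewrite /dyadic_exceedance -(bigcup_mkord _ (A n)); exists i.-1 => //=; rewrite /A /= iE.
apply: le_trans (score_statistic_mono n w k0 (ltnW klt)).
have T1 : 0 <= T n 1 w by exact: score_statistic_ge0.
have : (k%:R - 1) * ln n%:R <= T n k w.
  by rewrite mulrBl mul1r; move: Tk; rewrite mul1r; lra.
apply: le_trans; apply: ler_wpM2r; first exact: ltW.
have : (2 ^ i.+1)%:R <= 2 * k%:R :> R by rewrite -natrM ler_nat expnS leq_mul2l.
have : 2 <= k%:R :> R by rewrite ler_nat.
by lra.
Qed.

Lemma prob_dyadic_exceedance n : 1 < n%:R :> R ->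
  fine (P (dyadic_exceedance n)) <= 4 / ln 2 * (ln (kn n)%:R / ln n%:R).
Proof.
move=> n1; have L0 : 0 < ln (n%:R : R) by exact: ln_gt0.
have n0 : (0 < n)%N by case: n n1 {L0} => //; rewrite ltr10.
have mA i : measurable (A n i).
  rewrite -[X in measurable X]setTI.
  by apply: (measurable_fun_le measurableT) => //; exact: measurable_score_statistic.
have PA i : fine (P (A n i)) <= 4 / ln n%:R.
  have p0 : 0 < (2 ^ i.+2)%:R :> R by rewrite ltr0n expn_gt0.
  have t0 : 0 < (2 ^ i.+2)%:R / 4 * ln n%:R :> R by rewrite mulr_gt0// divr_gt0.
  have k0 : (0 < 2 ^ i.+2)%N by rewrite expn_gt0.
  apply: (le_trans (markov_Rintegral _ _ (integrable_score_statistic _ _) t0)).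
  - exact: measurable_score_statistic.
  - by move=> w; exact: score_statistic_ge0.
  - rewrite expectation_score_statistic// le_eqVlt; apply/orP; left; apply/eqP.
    by field; rewrite !gt_eqF.
have union m : fine (P (\big[setU/set0]_(i < m) A n i)) <= m%:R * (4 / ln n%:R).
  elim: m => [|m IH]; first by rewrite big_ord0 measure0 mul0r.
  have mU : measurable (\big[setU/set0]_(i < m) A n i) by exact: bigsetU_measurable.
  rewrite big_ord_recr /= -natr1 mulrDl mul1r.
  apply: le_trans (lerD IH (PA m)).
  rewrite -lee_fin EFinD !fineK ?fin_num_measure//; last exact: measurableU.
  exact: measureU2.
apply: (le_trans (union _)).
have l2 : 0 < ln (2 : R) by apply: ln_gt0; rewrite ltr1n.
have : (trunc_log 2 (kn n))%:R * ln 2 <= ln (kn n)%:R :> R.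
  rewrite mulr_natl -lnXn// ler_ln ?posrE ?exprn_gt0 ?ltr0n//.
  by rewrite -natrX ler_nat trunc_logP.
rewrite -ler_pdivlMr// => h.
apply: (le_trans (ler_wpM2r _ h)); first by rewrite divr_ge0// ltW.
rewrite le_eqVlt; apply/orP; left; apply/eqP.
by field; rewrite !gt_eqF.
Qed.
Variable lambda : nat -> R.
Hypothesis lambda_min : forall k, (0 < k)%N ->
  is_smallest_eigenvalue (Sig k) (lambda k).
Hypothesis kn_lambda :
  (ln (kn n)%:R / lambda (kn n)) / ln n%:R @[n --> \oo] --> (0 : R).

Let S11_gt0 : 0 < S 1 1.
Proof.
have [_ /(_ (const_mx 1))] := score_covariance_psd 1.
have := Sig_unit (ltnSn 0); rewrite unitmxE det_mx11 unitfE.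
rewrite /quad !mxE big_ord1 !mxE big_ord1 SigE !mxE mulr1 mul1r.
by rewrite le0r => /negbTE -> /=.
Qed.

Let T1E n w : T n 1 w = (bh n 1 w / Num.sqrt (S 1 1)) ^+ 2.
Proof.
have /matrixP /(_ 0 0) := mulmxV (Sig_unit (ltnSn 0)).
rewrite !mxE big_ord1 [in X in X * _ = _]SigE mxE => inv.
rewrite TE /quad !mxE big_ord1 !mxE big_ord1 !mxE -/(bh n 1 w).
rewrite exprMn exprVn sqr_sqrtr ?ltW// mulrAC -expr2; congr (_ * _).
by apply: (mulfI (lt0r_neq0 S11_gt0)); rewrite inv divff// lt0r_neq0.
Qed.

(** [lambda (kn n)] is positive and at most [S 1 1], so the ratio without the
    eigenvalue is at most [S 1 1] times the one with it. *)
Let ln_ratio_cvg0 : ln (kn n)%:R / ln n%:R @[n --> \oo] --> (0 : R).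
Proof.
have h : ln (kn n)%:R / lambda (kn n) / ln n%:R * S 1 1 @[n --> \oo] --> (0 : R).
  by rewrite -(mul0r (S 1 1)); apply: cvgM; [|exact: cvg_cst].
apply: (@squeeze_cvgr _ _ _ _ (cst 0)
  (fun n => ln (kn n)%:R / lambda (kn n) / ln n%:R * S 1 1));
  [|exact: cvg_cst|exact: h].
near=> n.
have n1 : 1 < n%:R :> R by rewrite ltr1n; near: n; exact: nbhs_infty_gt.
have L0 : 0 < ln (n%:R : R) by exact: ln_gt0.
have K0 : 0 <= ln ((kn n)%:R : R) by apply: ln_ge0; rewrite ler1n.
have l0 := smallest_eigenvalue_gt0 (score_covariance_psd _) (lambda_min (kn_gt0 n))
  (Sig_unit (kn_gt0 n)).
have lS := smallest_eigenvalue_le (score_covariance_psd _) (lambda_min (kn_gt0 n))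
  (Ordinal (kn_gt0 n)).
rewrite SigE mxE /= in lS.
apply/andP; split; first by rewrite divr_ge0// ltW.
rewrite /cst /= mulrAC; apply: ler_wpM2r; first by rewrite invr_ge0 ltW.
by rewrite mulrAC ler_pdivlMr// ler_wpM2l.
Unshelve. all: by end_near. Qed.

(** The result for scores of an i.i.d. sample that are centred with covariances
    [S], irrespective of the model that produces them. *)
Lemma data_driven_statistic_cvg :
  cvg_in_distribution P (fun n w => T n (Ssel psi al Sig X kn n w) w) (@chi_square1 R).
Proof.
pose s := Num.sqrt (S 1 1); have s0 : 0 < s by rewrite sqrtr_gt0.
pose v x := xi 1 x / s.
have mv : measurable_fun setT v.
  by apply: measurable_funM => //; exact: mxi.
have ix : P.-integrable setT (EFin \o (fun w => xi 1 (X 0 w))).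
  by apply: integrable_of_sqr; [exact: mxiX|exact: xi_sqr].
have mean0 : (\int[P]_w (v (X 0 w))%:E = 0)%E.
  rewrite -[LHS]fineK; last first.
    apply: integrable_fin_num => //.
    have := integrable_Rscale s^-1 ix.
    by apply: eq_integrable => // w _; rewrite /= mulrC.
  rewrite -[fine _]/(\int[P]_w (xi 1 (X 0 w) / s)) RintegralZr//.
  by rewrite xi_mean// mul0r.
have var1 : (\int[P]_w (v (X 0 w) ^+ 2)%:E = 1)%E.
  have vE w : v (X 0 w) ^+ 2 = (S 1 1)^-1 * (xi 1 (X 0 w) * xi 1 (X 0 w)).
    by rewrite /v exprMn exprVn sqr_sqrtr ?ltW// mulrC expr2.
  under eq_integral do rewrite vE.
  rewrite -[LHS]fineK; last first.
    by apply: integrable_fin_num => //; apply: integrable_Rscale; exact: ixi.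
  rewrite -[fine _]/(\int[P]_w ((S 1 1)^-1 * (xi 1 (X 0 w) * xi 1 (X 0 w)))).
  rewrite RintegralZl//; last exact: ixi.
  by rewrite xi_cov// mulVf// lt0r_neq0.
pose W n w := (Num.sqrt n%:R)^-1 * \sum_(i < n) v (X i w).
(* below n = 2 the logarithm is not positive and the bound is void *)
pose B n := if (1 < n)%N then dyadic_exceedance n else setT.
have TW n w : T n 1 w = W n w ^+ 2.
  rewrite T1E /W /v -mulr_suml mulrA; congr ((_ / _) ^+ 2).
apply: (@cvg_in_distribution_chi_square1 _ _ _ P W _ _ _ B) => //.
- move=> n; apply: measurable_funM => //; exact: measurable_partial_sum.
- by move=> a b; exact: (clt_logistic Xind mv Xlaw mean0 var1).
- move=> n; apply: measurable_first_argmax => k; last exact: measurable_score_statistic.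
  by apply: measurable_funB => //; exact: measurable_score_statistic.
- by move=> n; rewrite /B; case: ifP => // _; exact: measurable_dyadic_exceedance.
- move=> n w; rewrite /B; case: ifPn => n1 nB; last by exfalso; exact: nB.
  rewrite -TW; congr (T n _ w).
  apply: contrapT => S1; apply: nB; apply: selection_dyadic_exceedance => //.
  by rewrite ltr1n.
- move=> e e0; have l2 : 0 < ln (2 : R) by apply: ln_gt0; rewrite ltr1n.
  have : 4 / ln 2 * (ln (kn n)%:R / ln n%:R) @[n --> \oo] --> (0 : R).
    by rewrite -(mulr0 (4 / ln 2)); apply: cvgM; [exact: cvg_cst|].
  move=> /cvgrPdist_le /(_ _ e0) h.
  near=> n; have n1 : (1 < n)%N by near: n; exact: nbhs_infty_gt.
  rewrite /B n1; apply: (le_trans (prob_dyadic_exceedance _)); first by rewrite ltr1n.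
  rewrite (le_trans (ler_norm _))// -normrN -[- _]sub0r.
  by near: n.
Unshelve. all: by end_near. Qed.

End selection.
End scores.

(** * Convergence of the data driven statistic under the null hypothesis *)

Theorem proposition2p1 (R : realType)
  (* reference measure, densities of Y (true and null) and of Z *)
  (nu : {measure set (measurableTypeR R) -> \bar R})
  (nu_ref : reference_measure nu)
  (f f0 g : R -> R)
  (* the null model: Y0 of density f0, Z0 of density g, independent *)
  (d0 : measure_display) (Omega0 : measurableType d0)
  (P0 : probability Omega0 R) (Y0 Z0 : {RV P0 >-> R})
  (null_model : noise_model nu Y0 Z0 f0 g)
  (* the true model X = Y + Z, and the i.i.d. sample *)
  (d : measure_display) (Omega : measurableType d)
  (P : probability Omega R) (Y Z : {RV P >-> R})
  (true_model : noise_model nu Y Z f g)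
  (X : nat -> {RV P >-> R})
  (X_indep : mutually_independent P X)
  (X_law : forall i (A : set (measurableTypeR R)), measurable A ->
     law P (X i) A = law P (Y \+ Z) A)
  (h : R -> R)
  (h_density : has_density nu (law P (Y \+ Z)) h)
  (* the probability measure mu and the orthogonal basis of L^2(mu) *)
  (mu : probability (measurableTypeR R) R) (m : R -> R)
  (m_density : has_density nu mu m)
  (Y_dom : law P Y `<< mu) (X_dom : law P (Y \+ Z) `<< mu)
  (Q : nat -> R -> R)
  (Q_basis : orthogonal_basis mu Q)
  (h_L2 : h \in Lfun mu 2%:E)
  (* Sigma_k is well defined and invertible *)
  (Qm_L2 : forall j, (0 < j)%N -> (Qm Q m j \o (Y0 \+ Z0)) \in Lfun P0 2%:E)
  (Sigma_inv : forall k, (0 < k)%N ->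
     Sigma P0 (Qm Q m) (Y0 \+ Z0) k \in unitmx)
  (lambda : nat -> R)
  (lambda_min : forall k, (0 < k)%N ->
     is_smallest_eigenvalue (Sigma P0 (Qm Q m) (Y0 \+ Z0) k) (lambda k))
  (kn : nat -> nat)
  (kn_gt0 : forall n, (0 < kn n)%N)
  (kn_incr : {homo kn : n p / (n <= p)%N})
  (kn_infty : kn n @[n --> \oo] --> \oo)
  (* log k(n) / lambda_(k(n)) = o(log n) *)
  (kn_lambda :
     (ln (kn n)%:R / lambda (kn n)) / ln n%:R @[n --> \oo] --> (0 : R))
  (H0 : {ae nu, forall x, f x = f0 x}) :
  let Tk := Tstat (Qm Q m) (alpha P0 (Qm Q m) (Y0 \+ Z0))
              (Sigma P0 (Qm Q m) (Y0 \+ Z0)) X in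
  let Sn := Ssel (Qm Q m) (alpha P0 (Qm Q m) (Y0 \+ Z0))
              (Sigma P0 (Qm Q m) (Y0 \+ Z0)) X kn in
  cvg_in_distribution P (fun n w => Tk n (Sn n w) w) (@chi_square1 R).

Proof.
move=> Tk Sn; rewrite {}/Tk {}/Sn.
have [YZ0 fY0 gZ0] := null_model; have [YZ fY gZ] := true_model.
have lawY : forall A, measurable A -> law P Y A = law P0 Y0 A.
  exact: density_ae_eq fY fY0 H0.
have lawZ : forall A, measurable A -> law P Z A = law P0 Z0 A.
  by apply: density_ae_eq gZ gZ0 _; exact: aeW.
have lawX i (A : set (measurableTypeR R)) : measurable A ->
    P (X i @^-1` A) = P0 ((Y0 \+ Z0) @^-1` A).
  by move=> mA; rewrite [LHS](X_law i A mA); exact: law_add_eq.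
have mU : measurable_fun setT (Y0 \+ Z0) by exact: measurable_funD.
pose U : {mfun Omega0 >-> R} := mfun_Sub (mem_set mU : _ \in mfun).
pose psi := Qm Q m; pose al := alpha P0 psi (Y0 \+ Z0).
have mpsi j : measurable_fun [set: R] (psi j).
  have [mm _ _] := m_density; have [QL _ _ _] := Q_basis.
  apply: measurable_funM => //.
  by have := QL j; rewrite inE => /andP[]; rewrite inE.
pose xi j x := psi j x - al j.
have mxi j : measurable_fun [set: R] (xi j) by exact: measurable_funB.
have ipsi2 j : (0 < j)%N -> P0.-integrable setT (EFin \o (fun w => psi j (U w) ^+ 2)).
  by move=> j0; exact: Lfun2_integrable_sqr (Qm_L2 j j0).
have ipsi j : (0 < j)%N -> P0.-integrable setT (EFin \o (fun w => psi j (U w))).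
  move=> j0; apply: integrable_of_sqr; last exact: ipsi2.
  exact: measurableT_comp.
have icst (c : R) : P0.-integrable setT (EFin \o (fun _ => c)).
  exact: finite_measure_integrable_cst.
have ixi2 j : (0 < j)%N -> P0.-integrable setT (EFin \o (fun w => xi j (U w) ^+ 2)).
  move=> j0.
  have h1 := integrableB measurableT (ipsi2 j j0)
    (integrable_Rscale (2 * al j) (ipsi j j0)).
  have := integrableD measurableT h1 (icst (al j ^+ 2)).
  apply: eq_integrable => // w _; rewrite /= -EFinB -EFinD; congr EFin.
  by rewrite /xi; ring.
have xi0 j : (0 < j)%N -> \int[P0]_w xi j (U w) = 0.
  move=> j0; rewrite /xi RintegralB//; last exact: ipsi.
  rewrite Rintegral_cst//= probability_setT mulr1 /al /alpha.
  by rewrite unlock subrr.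
pose S i j := \int[P0]_w (xi i (U w) * xi j (U w)).
have transfer (phi : R -> R) a : measurable_fun [set: R] phi ->
    \int[P]_w phi (X a w) = \int[P0]_w phi (U w).
  move=> mphi; congr fine.
  apply: (integral_eq_law (U := X a) (U' := U) (phi := EFin \o phi)) => //.
  - exact: lawX.
  - exact/measurable_EFinP.
apply: (@data_driven_statistic_cvg _ _ _ P X psi al _ _ _ _ _ S).
- exact: X_indep.
- by move=> i A mA; rewrite !lawX.
- by move=> j _; exact: mpsi.
- move=> j a j0.
  apply: (integrable_eq_law (U := X a) (U' := U) (phi := fun x => (xi j x ^+ 2)%:E)).
  + exact: lawX.
  + by apply/measurable_EFinP; exact: measurable_funX.
  + exact: ixi2.
- by move=> j a j0; rewrite -(xi0 j j0) (transfer (xi j)).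
- move=> i j a i0 j0; rewrite (transfer (fun x => xi i x * xi j x))//.
  exact: measurable_funM.
- by move=> k; apply/matrixP => i j; rewrite !mxE /S /Rintegral /xi /al /alpha !unlock.
- exact: Sigma_inv.
- exact: kn_gt0.
- exact: lambda_min.
- exact: kn_lambda.
Qed.
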